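(* Let $r\ge1$ be an integer and $K,\lambda>0$. There is a constant $d\in\mathbb{N}$, depending only on $r$, $\lambda$ and $K$, such that for every local energy $S$ with range $r$ and constants $K,\lambda$, and every global minimizer $x\in\mathcal{M}$, one of the following two cases holds. (i) $x$ is a Birkhoff sequence. (ii) $x$ is not a Birkhoff sequence, and there are monotone infinite sequences of integers $(k_n)_{n\in\mathbb{N}}$, $(l_n)_{n\in\mathbb{N}}$ with $|k_{n+1}-k_n|\le d$ and $|l_n-k_n|\le r$ such that one of the following inequalities holds for all $n\in\mathbb{N}$: $$(x_{k_n+1}-x_{k_n}+1)(x_{l_n}-x_{l_n+1}+1)\ge 2^n,\quad\text{or}\quad (x_{k_n+1}-x_{k_n}-1)(x_{l_n}-x_{l_n+1}-1)\ge 2^n .$$ Moreover, for every $n$ at least one of the following holds: $$x_{k_n+1}-x_{k_n}\ge 2^{n/2}-1,\quad\text{or}\quad x_{l_n}-x_{l_n+1}\ge 2^{n/2}-1 .$$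
   Context: Let $r\ge 1$ be an integer. A local energy with range $r$ and constants $K,\lambda>0$ is a function $S\in C^2(\mathbb{R}^{r+1})$ for which there are $f_1,\dots,f_r\in C^2(\mathbb{R}^2)$ with $S(\xi_1,\dots,\xi_{r+1})=\sum_{j=1}^r f_j(\xi_1,\xi_{j+1})$ such that for every $1\le j\le r$: (1) $f_j(\nu+1,\mu+1)=f_j(\nu,\mu)$; (2) $\|\partial_{i,k}f_j\|_{\sup}\le K/r$ for all $i,k\in\{1,2\}$; (3) $f_j(\nu,\mu)\to\infty$ as $|\nu-\mu|\to\infty$; (4) $\partial_1\partial_2 f_j(\nu,\mu)\le-\lambda<0$ for all $\nu,\mu\in\mathbb{R}$. For $x\in\mathbb{R}^{\mathbb{Z}}$ put $S_j(x):=S(x_j,\dots,x_{j+r})$. For integers $i_0\le i_1$ let $B=[i_0-r,i_1]\subset\mathbb{Z}$, with interior $\mathring{B}=[i_0,i_1]$, and $W_B(x):=\sum_{i\in B}S_i(x)$. A sequence $x\in\mathbb{R}^{\mathbb{Z}}$ is a global minimizer if $W_B(x)\le W_B(x+v)$ for every such $B$ and every $v\in\mathbb{R}^{\mathbb{Z}}$ supported in $\mathring{B}$; $\mathcal{M}$ is the set of global minimizers. For $k,l\in\mathbb{Z}$ the translation is $(\tau_{k,l}x)_i:=x_{i-k}+l$. We write $x\le y$ if $x_i\le y_i$ for all $i\in\mathbb{Z}$. A sequence $x$ is Birkhoff if for all $(k,l)\in\mathbb{Z}\times\mathbb{Z}$ either $\tau_{k,l}x\le x$ or $\tau_{k,l}x\ge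 x$. *)

(* Defs.v *)
From mathcomp Require Export all_boot all_order all_algebra.
From mathcomp Require Export all_classical all_reals all_analysis.
Export numFieldNormedType.Exports.
Set Implicit Arguments.
Unset Strict Implicit.
Unset Printing Implicit Defensive.
Import Order.TTheory GRing.Theory Num.Theory.
Local Open Scope classical_set_scope.
Local Open Scope ring_scope.

Section Smoothness.
Context {R : realType} {n : nat}.
Implicit Type f : 'rV[R]_n -> R.

Definition partial (i : 'I_n) f : 'rV[R]_n -> R := 'D_(delta_mx 0 i) f.

Definition C1 f : Prop := forall i : 'I_n,
  (forall p, derivable f p (delta_mx 0 i)) /\ continuous (partial i f).

Definition C2 f : Prop := C1 f /\ forall i : 'I_n, C1 (partial i f).

End Smoothness.

Section LocalEnergy.
Context {R : realType}.

Definition pt (nu mu : R) : 'rV[R]_2 := \row_k [:: nu; mu]`_k.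

Definition pair_potential (r : nat) (K lambda : R) (f : 'rV[R]_2 -> R) : Prop :=
  [/\ C2 f
    , forall nu mu, f (pt (nu + 1) (mu + 1)) = f (pt nu mu)
    , forall (i k : 'I_2) p, `|partial i (partial k f) p| <= K / r%:R
    , forall M : R, exists L : R, forall nu mu,
        L <= `|nu - mu| -> M <= f (pt nu mu)
    & forall nu mu, partial ord0 (partial ord_max f) (pt nu mu) <= - lambda].

Definition local_energy (r : nat) (K lambda : R) (S : 'rV[R]_r.+1 -> R) : Prop :=
  C2 S /\ exists f : 'I_r -> 'rV[R]_2 -> R,
    (forall j, pair_potential r K lambda (f j)) /\
    (forall xi, S xi = \sum_(j < r) f j (pt (xi 0 ord0) (xi 0 (lift ord0 j)))).

Definition energy_at r (S : 'rV[R]_r.+1 -> R) (x : int -> R) (j : int) : R :=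
  S (\row_(k < r.+1) x (j + k%:Z)).

(* The sum is a finitely supported sum over a set of integers; it is only
   used for intervals, which are finite. *)
Definition W r (S : 'rV[R]_r.+1 -> R) (B : set int) (x : int -> R) : R :=
  \sum_(i \in B) energy_at S x i.

Definition global_minimizer r (S : 'rV[R]_r.+1 -> R) (x : int -> R) : Prop :=
  forall (i0 i1 : int), i0 <= i1 ->
  let B := [set i : int | i0 - r%:Z <= i <= i1] in
  forall v : int -> R, (forall i : int, ~~ (i0 <= i <= i1) -> v i = 0) ->
  W S B x <= W S B (fun i => x i + v i).

Definition translate (k l : int) (x : int -> R) : int -> R :=
  fun i => x (i - k) + l%:~R.

Definition le_seqZ (x y : int -> R) : Prop := forall i, x i <= y i.

Definition Birkhoff (x : int -> R) : Prop := forall k l : int,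
  le_seqZ (translate k l x) x \/ le_seqZ x (translate k l x).

End LocalEnergy.

Definition monotone_seq (u : nat -> int) : Prop :=
  nondecreasing_seq u \/ nonincreasing_seq u.

(* Main.v *)
Require Import Defs.
From mathcomp Require Import zify ring lra.
Set Implicit Arguments.
Unset Strict Implicit.
Unset Printing Implicit Defensive.
Import Order.TTheory GRing.Theory Num.Theory.
Local Open Scope ring_scope.

(** Let y = translate k l x be a translate of the minimizer x, and let n and p be
    the negative and positive parts of x - y.  Exchanging x and y at the sites of
    an interval where x < y, minimality of x and y and the twist condition bound the
    sum of n_i p_j over close pairs of the interval by a constant times the sum over
    its two ends of N N', where N and N' are the sums of n over the two blocks of
    length r on either side of the end; the same holds with p in place of n.
    Multiplying the two bounds at one end turns N N' P P' into a product of crossing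
    sums, so crossing sums which are unbounded in one direction grow there by a
    constant factor every r sites.

    If they are bounded in both directions, the bounds force x - y to be
    essentially negative at one end of Z and essentially positive at the other, so
    that x moves away from the line of slope l / k on the same side at both ends.
    A (k, l)-periodic minimizer then crosses x on a nonempty finite set only, which
    contradicts minimality.  This needs k = 1 or bounded steps
    D_i = x_i - x_(i - 1).

    Finally, if no translate by one site crosses x then the steps are bounded and
    exponential growth is impossible, so x is Birkhoff; otherwise D - c changes
    sign for some integer c, D is unbounded in both directions, and the
    growth for k = 1 and l = 0 is the claim. *)

(** * Exponential growth of crossing sums *)

Section Windows.
Context {R : realType} (r : nat).
Implicit Types n p : nat -> R.

Definition crossN n p (L : nat) : R :=
  \sum_(i < L) \sum_(j < L | (i <= j + r)%N && (j <= i + r)%N) n i * p j.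

Definition winN n (a : nat) : R := \sum_(i < r) n (a + i)%N.

Lemma crossN_sym n p L : crossN n p L = crossN p n L.
Proof.
rewrite /crossN (exchange_big_dep predT)//=; apply: eq_bigr => j _.
by apply: eq_big => [i|i _]; [exact: andbC|exact: mulrC].
Qed.

Lemma winN_ge0 n a : (forall i, 0 <= n i) -> 0 <= winN n a.
Proof. by move=> n0; apply: sumr_ge0. Qed.

Section Nonneg.
Context {n p : nat -> R} (n0 : forall i, 0 <= n i) (p0 : forall i, 0 <= p i).

Lemma crossN_ge0 L : 0 <= crossN n p L.
Proof. by apply: sumr_ge0 => i _; apply: sumr_ge0 => j _; exact: mulr_ge0. Qed.

Lemma crossN_term L i j : (i < L)%N -> (j < L)%N -> (i <= j + r)%N ->
  (j <= i + r)%N -> n i * p j <= crossN n p L.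
Proof.
move=> iL jL ij ji; rewrite /crossN (bigD1 (Ordinal iL))//=.
rewrite (bigD1 (Ordinal jL)) /=; last by rewrite ij ji.
have np a b : 0 <= n a * p b by exact: mulr_ge0.
rewrite -addrA lerDl addr_ge0 ?sumr_ge0// => a _.
by rewrite sumr_ge0.
Qed.

Lemma crossN_block L :
  crossN n p L + winN n L * winN p L <= crossN n p (L + r).
Proof.
have np a b : 0 <= n a * p b by exact: mulr_ge0.
rewrite /crossN big_split_ord /=; apply: lerD.
  apply: ler_sum => i _.
  rewrite [leRHS]big_mkcond/= big_split_ord/= -big_mkcond /= lerDl.
  by apply: sumr_ge0 => j _; case: ifP.
rewrite /winN mulr_suml; apply: ler_sum => i _.
rewrite mulr_sumr [leRHS]big_mkcond/= big_split_ord/= -[leLHS]add0r lerD//.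
  by apply: sumr_ge0 => j _; case: ifP.
by apply: ler_sum => j _; rewrite ifT//; have := ltn_ord i; have := ltn_ord j; lia.
Qed.

Lemma win_le_crossN L : (r <= L)%N ->
  winN n (L - r) * winN p (L - r) <= crossN n p L.
Proof.
move=> rL; have := crossN_block (L - r); rewrite subnK//.
by apply: le_trans; rewrite lerDr crossN_ge0.
Qed.

Lemma crossN_mono L L' : (L <= L')%N -> crossN n p L <= crossN n p L'.
Proof.
have np a b : 0 <= n a * p b by exact: mulr_ge0.
move=> /subnKC <-; rewrite /crossN big_split_ord/= -[leLHS]addr0 lerD//.
  apply: ler_sum => i _.
  rewrite [leRHS]big_mkcond/= big_split_ord/= -big_mkcond /= lerDl.
  by apply: sumr_ge0 => j _; case: ifP.
by apply: sumr_ge0 => i _; apply: sumr_ge0.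
Qed.

Lemma winN_large_term a C : 0 <= C -> (r * r)%:R * C < winN n a * winN p a ->
  exists i j, [/\ (a <= i < a + r)%N, (a <= j < a + r)%N & C <= n i * p j].
Proof.
move=> C0 big; apply: contrapT => H; move: big; apply/negP; rewrite -leNgt.
have small (i j : 'I_r) : n (a + i)%N * p (a + j)%N <= C.
  rewrite leNgt; apply/negP => h; apply: H; exists (a + i)%N, (a + j)%N.
  by split; rewrite ?(ltW h)//; [have := ltn_ord i|have := ltn_ord j]; lia.
rewrite /winN mulr_suml (@le_trans _ _ (\sum_(i < r) \sum_(j < r) C))//.
  by apply: ler_sum => i _; rewrite mulr_sumr; apply: ler_sum.
by rewrite !sumr_const !card_ord -mulrnA mulr_natl.
Qed.

Lemma growth_of_unbounded (theta C0 : R) (s : nat) :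
  (0 < r)%N -> 0 < theta -> 2 <= (1 + theta ^+ 2) ^+ s ->
  (forall L, (r <= L)%N ->
     2 * theta * crossN n p L <= C0 + winN n (L - r) * winN n L) ->
  (forall L, (r <= L)%N ->
     2 * theta * crossN n p L <= C0 + winN p (L - r) * winN p L) ->
  (forall B, exists L, B < crossN n p L) ->
  exists m : nat, forall q : nat, exists i j,
    [/\ (m + q * (s * r) <= i < m + q * (s * r) + r)%N,
        (m + q * (s * r) <= j < m + q * (s * r) + r)%N & 2 ^+ q <= p i * n j].
Proof.
move=> r0 th0 hs Hn Hp unb.
have th2 : 0 < theta ^+ 2 by rewrite exprn_gt0.
have [L0 hL0] := unb (`|C0| / theta + ((r * r)%:R + 1) / theta ^+ 2).
pose L1 := (L0 + r)%N.
have rL1 : (r <= L1)%N by rewrite leq_addl.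
have T1 L : (L1 <= L)%N ->
    `|C0| / theta + ((r * r)%:R + 1) / theta ^+ 2 <= crossN n p L.
  move=> L1L; rewrite (le_trans (ltW hL0))// crossN_mono//.
  by rewrite (leq_trans _ L1L)// leq_addr.
have C0T L : (L1 <= L)%N -> C0 <= theta * crossN n p L.
  move=> L1L; rewrite mulrC -ler_pdivrMr//; apply: le_trans (T1 L L1L).
  rewrite ler_wpDr ?divr_ge0 ?addr_ge0 ?(ltW th2)//.
  by rewrite ler_pM2r ?invr_gt0// ler_norm.
have T0 L : (L1 <= L)%N -> 0 < crossN n p L.
  move=> L1L; apply: lt_le_trans (T1 L L1L); rewrite ltr_wpDl//.
    by rewrite divr_ge0// ltW.
  by rewrite divr_gt0// ltr_wpDl.
have step L : (L1 <= L)%N ->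
    theta ^+ 2 * crossN n p L <= winN n L * winN p L.
  move=> L1L; have rL := leq_trans rL1 L1L.
  have a1 : theta * crossN n p L <= winN n (L - r) * winN n L.
    by have := Hn _ rL; have := C0T _ L1L; lra.
  have a2 : theta * crossN n p L <= winN p (L - r) * winN p L.
    by have := Hp _ rL; have := C0T _ L1L; lra.
  have tT0 : 0 <= theta * crossN n p L by rewrite mulr_ge0 ?ltW ?T0.
  have := ler_pM tT0 tT0 a1 a2.
  have W0 : 0 <= winN n L * winN p L by rewrite mulr_ge0 ?winN_ge0.
  have := ler_wpM2r W0 (win_le_crossN rL).
  move=> h1 h2; rewrite -(ler_pM2l (T0 _ L1L)).
  apply: le_trans h1; rewrite [leRHS](_ : _ = (winN n (L - r) * winN n L) *
    (winN p (L - r) * winN p L)); last by ring.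
  by apply: le_trans h2; rewrite le_eqVlt; apply/orP; left; apply/eqP; ring.
have grow L : (L1 <= L)%N ->
    (1 + theta ^+ 2) * crossN n p L <= crossN n p (L + r).
  move=> L1L; apply: le_trans (crossN_block L).
  by rewrite mulrDl mul1r lerD2l step.
have growk q : (1 + theta ^+ 2) ^+ q * crossN n p L1 <= crossN n p (L1 + q * r).
  elim: q => [|q IH]; first by rewrite mul1r mul0n addn0.
  rewrite mulSn (addnC r) addnA.
  apply: le_trans (grow _ (leq_addr _ _)).
  by rewrite exprS -mulrA ler_wpM2l// addr_ge0// ltW.
exists L1 => q; set a := (L1 + _)%N.
have pw : 2 ^+ q * crossN n p L1 <= crossN n p a.
  apply: le_trans (_ : (1 + theta ^+ 2) ^+ (q * s) * crossN n p L1 <= _).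
    rewrite ler_wpM2r ?crossN_ge0// mulnC exprM.
    by rewrite lerXn2r// nnegrE// exprn_ge0// addr_ge0// ltW.
  by rewrite /a mulnA growk.
have [i [j [hi hj hij]]] : exists i j,
  [/\ (a <= i < a + r)%N, (a <= j < a + r)%N & 2 ^+ q <= n i * p j].
  apply: winN_large_term; first by rewrite exprn_ge0.
  apply: lt_le_trans (step a (leq_addr _ _)).
  have q0 : 0 < (2 : R) ^+ q by rewrite exprn_gt0.
  have h1 : theta ^+ 2 * (2 ^+ q * crossN n p L1) <= theta ^+ 2 * crossN n p a.
    by rewrite ler_pM2l.
  apply: lt_le_trans h1; rewrite mulrCA (mulrC _ (2 ^+ q)) ltr_pM2l//.
  rewrite mulrC -ltr_pdivrMr//; apply: lt_le_trans (T1 L1 (leqnn _)).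
  rewrite -[ltLHS]add0r; apply: ler_ltD; first by rewrite divr_ge0// ltW.
  by rewrite ltr_pM2r ?invr_gt0// ltrDl.
by exists j, i; split=> //; rewrite mulrC.
Qed.

End Nonneg.
End Windows.

Section Mixed.
Context {R : realType} (r : nat).

Lemma sum_shift_le (F : nat -> R) (P : pred nat) a m N :
  (forall i, 0 <= F i) -> (a + m <= N)%N ->
  (forall j, (a <= j < a + m)%N -> P j) ->
  \sum_(j < m) F (a + j)%N <= \sum_(j < N | P j) F j.
Proof.
move=> F0 /subnKC <- HP; rewrite -addnA [leRHS]big_mkcond/= !big_split_ord/=.
have PF j : 0 <= (if P j then F j else 0) by case: ifP.
rewrite -[leLHS]add0r lerD//; first by apply: sumr_ge0.
rewrite -[leLHS]addr0 lerD//; last by apply: sumr_ge0.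
by apply: ler_sum => j _; rewrite HP//; have := ltn_ord j; lia.
Qed.

Lemma sum_diverges (n p : nat -> R) (B delta : R) (L0 : nat) :
  (forall i, 0 <= n i) -> (forall i, 0 <= p i) ->
  (forall L, crossN r n p L <= B) -> 0 < delta -> (r <= L0)%N ->
  (forall L, (L0 <= L)%N -> delta <= winN r p (L - r) * winN r p L) ->
  forall C, exists L1, forall L, (L1 <= L)%N -> C <= \sum_(i < L) (p i - n i).
Proof.
move=> n0 p0 bnd d0 rL0 hw C.
pose e := Num.sqrt delta; have e0 : 0 < e by rewrite sqrtr_gt0.
have we L : (L0 <= L)%N -> e <= winN r p (L - r) + winN r p L.
  move=> L0L; have W0 a : 0 <= winN r p a by exact: winN_ge0.
  rewrite leNgt; apply/negP => lt.
  have := hw _ L0L; apply/negP; rewrite -ltNge.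
  have -> : delta = e * e by rewrite -expr2 sqr_sqrtr// ltW.
  by have := W0 (L - r)%N; have := W0 L; move=> ? ?; apply: ltr_pM => //; lra.
have sumn L : \sum_(i < L0 + L) n i <= \sum_(i < L0) n i + B / e.
  rewrite big_split_ord/= lerD2l ler_pdivlMr//.
  apply: le_trans (bnd (L0 + L + r)%N); rewrite /crossN.
  rewrite -addnA [leRHS]big_split_ord/= -[leLHS]add0r lerD//.
    by apply: sumr_ge0 => i _; apply: sumr_ge0 => j _; exact: mulr_ge0.
  rewrite [leRHS]big_split_ord/= -[leLHS]addr0 lerD//; last first.
    by apply: sumr_ge0 => i _; apply: sumr_ge0 => j _; exact: mulr_ge0.
  rewrite mulr_suml; apply: ler_sum => i _; rewrite -mulr_sumr ler_wpM2l//.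
  apply: le_trans (we (L0 + i)%N (leq_addr _ _)) _.
  have -> : winN r p (L0 + i - r) + winN r p (L0 + i) =
      \sum_(j < r + r) p (L0 + i - r + j)%N.
    rewrite big_split_ord/=; congr (_ + _); apply: eq_bigr => j _.
    by congr p; lia.
  apply: (@sum_shift_le _ (fun j => (L0 + i <= j + r)%N && (j <= L0 + i + r)%N)).
  - by [].
  - by have := ltn_ord i; lia.
  - by move=> j; lia.
have sump q : q%:R * e <= \sum_(i < L0 + q * (r + r)) p i.
  elim: q => [|q IH]; first by rewrite mul0r sumr_ge0.
  rewrite mulSn (addnC (r + r)%N) addnA big_split_ord/= -natr1 mulrDl mul1r lerD//.
  apply: le_trans (we (L0 + q * (r + r) + r)%N _) _; first by lia.
  rewrite addnK big_split_ord/= lerD//.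
  by rewrite le_eqVlt; apply/orP; left; apply/eqP; apply: eq_bigr => j _; rewrite addnA.
pose D := C + (\sum_(i < L0) n i + B / e).
pose q := (Num.truncn (`|D| / e)).+1.
exists (L0 + q * (r + r))%N => L hL.
rewrite sumrB lerBrDr.
have -> : L = (L0 + (L - L0))%N by lia.
apply: le_trans (_ : D <= _); first by rewrite lerD2l.
apply: le_trans (_ : q%:R * e <= _).
  rewrite -ler_pdivrMr// ltW// (le_lt_trans _ (truncnS_gt _))//.
  by rewrite ler_pM2r ?invr_gt0// ler_norm.
apply: le_trans (sump q) _; apply: (@sum_shift_le _ xpredT 0%N) => //; lia.
Qed.

End Mixed.

(** * Exchanging two minimizers *)

Section Potential.
Context {R : realType}.
Implicit Types (f : R -> R -> R) (a b t : R).

(* The second clause is lam <= - d1 d2 f <= kap for mixed second differences, and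
   the next two are d1 d1 f <= kap and d2 d2 f <= kap. *)
Definition twist_pot (lam kap : R) f : Prop :=
  [/\ forall a b, f (a + 1) (b + 1) = f a b,
      forall a a' b b', a <= a' -> b <= b' ->
        lam * ((a' - a) * (b' - b)) <= f a' b + f a b' - f a' b' - f a b
          <= kap * ((a' - a) * (b' - b)),
      (forall a b t, f (a + t) b + f (a - t) b - 2 * f a b <= kap * t ^+ 2),
      (forall a b t, f a (b + t) + f a (b - t) - 2 * f a b <= kap * t ^+ 2)
    & (forall b, continuous (f^~ b)) /\ (forall a, continuous (f a))].

Definition gap a b : R := Num.max (b - a) 0.

Lemma gap_ge0 a b : 0 <= gap a b.
Proof. by rewrite /gap le_max lexx orbT. Qed.

Lemma gap_lt a b : a <= b -> gap a b = b - a.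
Proof. by move=> ab; rewrite /gap max_l// subr_ge0. Qed.

Lemma gap_gt0 a b : (0 < gap a b) = (a < b).
Proof. by rewrite /gap lt_max ltxx orbF subr_gt0. Qed.

Lemma gap_ge a b : b <= a -> gap a b = 0.
Proof. by move=> ab; rewrite /gap max_r// subr_le0. Qed.

Lemma gapM a b : gap a b * gap b a = 0.
Proof.
by have [/gap_ge ->|/ltW/gap_ge ->] := leP a b; rewrite ?mulr0// mul0r.
Qed.

Lemma pair_swap lam kap f (I J : bool) a b a' b' :
  0 <= lam -> 0 <= kap -> twist_pot lam kap f ->
  f (if (a < a') && I then a' else a) (if (b < b') && J then b' else b) +
  f (if (a < a') && I then a else a') (if (b < b') && J then b else b') <=
  f a b + f a' b' - lam * (if I && J then gap a a' * gap b' b + gap a' a * gap b b' else 0)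
  + kap * (if I (+) J then gap a a' * gap b b' else 0).
Proof.
move=> l0 k0 [_ mix _ _ _].
have [aa|aa] := ltP a a'; have [bb|bb] := ltP b b';
  rewrite ?(gap_lt (ltW aa)) ?(gap_ge (ltW aa)) ?(gap_ge aa) ?(gap_lt aa)
          ?(gap_lt (ltW bb)) ?(gap_ge (ltW bb)) ?(gap_ge bb) ?(gap_lt bb);
  case: I; case: J; rewrite /= ?mulr0 ?mul0r ?addr0 ?subr0 ?add0r ?mulr0 ?addr0 ?subr0;
  try lra.
- by have /andP[_] := mix _ _ _ _ (ltW aa) (ltW bb); lra.
- by have /andP[_] := mix _ _ _ _ (ltW aa) (ltW bb); lra.
- by have /andP[+ _] := mix _ _ _ _ (ltW aa) bb; lra.
- have /andP[+ _] := mix _ _ _ _ (ltW aa) bb.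
  by have : 0 <= lam * ((a' - a) * (b - b')); [rewrite !mulr_ge0// subr_ge0// ltW|lra].
- by have /andP[+ _] := mix _ _ _ _ aa (ltW bb); lra.
- have /andP[+ _] := mix _ _ _ _ aa (ltW bb).
  by have : 0 <= lam * ((a - a') * (b' - b)); [rewrite !mulr_ge0// subr_ge0// ltW|lra].
Qed.

Lemma pair_pert lam kap f (I J : bool) a b a' b' t :
  twist_pot lam kap f -> 0 <= t -> ~~ (I && J) ->
  a <= a' -> b <= b' -> (I -> a' = a) -> (J -> b' = b) ->
  f (a' + I%:R * t) (b' + J%:R * t) <=
  f a' b' + kap * t ^+ 2 * (I%:R + J%:R)
  - (f (a - I%:R * t) (b - J%:R * t) - f a b)
  - lam * t * (I%:R * (b' - b) + J%:R * (a' - a)).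
Proof.
move=> [_ mix sd1 sd2 _] t0; case: I; case: J => //= _ aa bb Ia Ja;
  rewrite ?mul0r ?mul1r ?addr0 ?subr0 ?add0r; last by lra.
- have ta : a <= a + t by rewrite lerDl.
  by rewrite Ia//; have /andP[+ _] := mix _ _ _ _ ta bb; have := sd1 a b t; lra.
- have tb : b <= b + t by rewrite lerDl.
  by rewrite Ja//; have /andP[+ _] := mix _ _ _ _ aa tb; have := sd2 a b t; lra.
Qed.

End Potential.

Section Sums.
Context {R : realType}.

Lemma sum_shift_eq (F : nat -> R) a m N : (a + m <= N)%N ->
  \sum_(j < m) F (a + j)%N = \sum_(j < N) if (a <= j < a + m)%N then F j else 0.
Proof.
move=> /subnKC <-; rewrite -addnA !big_split_ord/=.
rewrite [X in _ = X + _]big1; last first.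
  by move=> j _; rewrite ifF//; have := ltn_ord j; lia.
rewrite add0r [X in _ = _ + X]big1 ?addr0; last first.
  by move=> j _; rewrite ifF//; lia.
by apply: eq_bigr => j _; rewrite ifT//; have := ltn_ord j; lia.
Qed.

Lemma sum_eqn_le (s c M : nat) : \sum_(i < M) ((i + c)%N == s)%:R <= 1 :> R.
Proof.
suff -> : \sum_(i < M) ((i + c)%N == s)%:R = (c <= s < M + c)%N%:R :> R.
  by case: (_ <= _ < _)%N.
elim: M => [|M IH].
  by rewrite big_ord0; have -> : (c <= s < 0 + c)%N = false by lia.
rewrite big_ord_recr/= IH.
have -> : (c <= s < M.+1 + c)%N = (c <= s < M + c)%N || ((M + c)%N == s) by lia.
by case: eqP => [<-|_]; rewrite ?ltnn ?andbF ?orbF ?add0r ?addr0.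
Qed.

End Sums.

Section Windows.
Context {R : realType} (r : nat).

Definition shift (x : int -> R) (a : int) (i : nat) : R := x (a + i%:Z).
Definition cross (n p : int -> R) (a : int) (L : nat) : R :=
  crossN r (shift n a) (shift p a) L.
Definition wind (n : int -> R) (a : int) : R := winN r (shift n a) 0%N.
Definition flux (n : int -> R) (a : int) : R := wind n (a - r%:Z) * wind n a.
Definition gapZ (x y : int -> R) (i : int) : R := gap (x i) (y i).

Lemma winN_shift n a b : winN r (shift n a) b = wind n (a + b%:Z).
Proof. by apply: eq_bigr => i _; rewrite /shift; congr n; lia. Qed.

End Windows.

Section Energy.
Context {R : realType} {r : nat} (lam kap : R) (F : 'I_r -> R -> R -> R).
Hypotheses (lam_ge0 : 0 <= lam) (kap_ge0 : 0 <= kap).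
Hypothesis FP : forall k, twist_pot lam kap (F k).
Implicit Types x y : nat -> R.

Definition EnN (M : nat) x : R :=
  \sum_(i < M) \sum_(k < r) F k (x i) (x (i + k.+1)%N).

Definition swapN (L : nat) x y (i : nat) : R :=
  if (x i < y i) && (r <= i < r + L)%N then y i else x i.

Definition swapN' (L : nat) x y (i : nat) : R :=
  if (x i < y i) && (r <= i < r + L)%N then x i else y i.

Lemma EnN_swap L x y (n := fun i => gap (x i) (y i))
    (p := fun i => gap (y i) (x i)) :
  EnN (r + L) (swapN L x y) + EnN (r + L) (swapN' L x y) <=
  EnN (r + L) x + EnN (r + L) y
  - lam * crossN r (fun i => n (r + i)%N) (fun i => p (r + i)%N) L
  + kap * (winN r n 0 * winN r n r + winN r n L * winN r n (r + L)).
Proof.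
have n0 i : 0 <= n i by exact: gap_ge0.
have p0 i : 0 <= p i by exact: gap_ge0.
pose I i := (r <= i < r + L)%N; pose N := (r + L + r)%N.
have cvt (G : nat -> nat -> R) : \sum_(i < r + L) \sum_(k < r) G i (i + k.+1)%N =
    \sum_(i < r + L) \sum_(j < N) if (i < j <= i + r)%N then G i j else 0.
  apply: eq_bigr => i _; under eq_bigr do rewrite addnS -addSn.
  rewrite (@sum_shift_eq _ (G i) i.+1 r N) //.
  by have := ltn_ord i; rewrite /N; lia.
pose Gc i j := if I i && I j then n i * p j + p i * n j else 0.
pose Gb i j := if I i (+) I j then n i * n j else 0.
have H1 : EnN (r + L) (swapN L x y) + EnN (r + L) (swapN' L x y) <=
  EnN (r + L) x + EnN (r + L) y
  - lam * (\sum_(i < r + L) \sum_(k < r) Gc i (i + k.+1)%N)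
  + kap * \sum_(i < r + L) \sum_(k < r) Gb i (i + k.+1)%N.
  rewrite /EnN !mulr_sumr -sumrN -!big_split/=; apply: ler_sum => i _.
  rewrite !mulr_sumr -sumrN -!big_split/=; apply: ler_sum => k _.
  exact: pair_swap.
apply: le_trans H1 _; apply: lerD.
  rewrite lerD2l lerN2 ler_wpM2l// cvt.
  pose H a b := if (a <= b + r)%N && (b <= a + r)%N then n a * p b else 0.
  have -> : crossN r (fun i => n (r + i)%N) (fun i => p (r + i)%N) L =
      \sum_(i < N) \sum_(j < N) if I i && I j then H i j else 0.
    transitivity (\sum_(i < L) \sum_(j < N) if I j then H (r + i)%N j else 0).
      apply: eq_bigr => i _; rewrite -sum_shift_eq; last by rewrite /N; lia.
      rewrite big_mkcond/=; apply: eq_bigr => j _.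
      by rewrite /H -!addnA !leq_add2l.
    rewrite (@sum_shift_eq _ (fun a => \sum_(j < N) if I j then H a j else 0) r L N);
      last by rewrite /N; lia.
    apply: eq_bigr => i _; rewrite /I; case: ifP => //= _.
    by rewrite big1.
  have -> : \sum_(i < r + L) \sum_(j < N) (if (i < j <= i + r)%N then Gc i j else 0) =
      \sum_(i < N) \sum_(j < N) if (i < j <= i + r)%N then Gc i j else 0.
    rewrite [RHS]big_split_ord/= [X in _ = _ + X]big1 ?addr0// => i _.
    rewrite big1// => j _; rewrite /Gc (_ : I _ = false) ?if_same//.
    by rewrite /I; lia.
  pose G1 i j := if [&& (i < j <= i + r)%N, I i & I j] then n i * p j else 0.
  pose G2 i j := if [&& (j < i <= j + r)%N, I i & I j] then n i * p j else 0.
  apply: (@le_trans _ _ (\sum_(i < N) \sum_(j < N) (G1 i j + G2 i j))).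
    apply: ler_sum => i _; apply: ler_sum => j _; rewrite /G1 /G2 /H.
    have [->|ij] := eqVneq (i : nat) (j : nat).
      by rewrite /n /p gapM !if_same addr0.
    case: (I i); case: (I j); rewrite ?andbF ?addr0//= !andbT.
    have [h1|h1] := boolP (i < j <= i + r)%N;
      have [h2|h2] := boolP (j < i <= j + r)%N; case: ifP => h3;
      rewrite ?addr0 ?add0r//; try lia.
  under eq_bigr do rewrite big_split/=.
  rewrite big_split/= [X in _ + X]exchange_big/= -big_split/=.
  apply: ler_sum => i _; rewrite -big_split/=; apply: ler_sum => j _.
  rewrite /G1 /G2 /Gc (andbC (I j)) [p i * _]mulrC.
  by case: (I i && I j); rewrite ?andbF ?andbT ?if_same ?addr0//; case: ifP; rewrite ?addr0.
rewrite cvt ler_wpM2l//.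
pose B1 i j := if (i < r)%N then (if (r <= j < r + r)%N then n i * n j else 0) else 0.
pose B2 i j := if (L <= i < L + r)%N then (if (r + L <= j < r + L + r)%N then n i * n j else 0) else 0.
have W a b G : (a + r <= N)%N -> (b + r <= N)%N ->
  (forall i j, G i j = if (a <= i < a + r)%N then
      (if (b <= j < b + r)%N then n i * n j else 0) else 0) ->
  winN r n a * winN r n b = \sum_(i < N) \sum_(j < N) G i j.
  move=> aN bN HG; rewrite /winN mulr_suml.
  rewrite (@sum_shift_eq _ (fun i => n i * winN r n b) a r N)//.
  apply: eq_bigr => i _; rewrite /winN mulr_sumr.
  rewrite (@sum_shift_eq _ (fun j => n i * n j) b r N)//.
  by case: ifP => ha; [apply: eq_bigr|rewrite big1//] => j _; rewrite HG ha.
rewrite (W 0%N r B1)//; [|by rewrite /N; lia|by rewrite /N; lia].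
rewrite (W L (r + L)%N B2)//; last by rewrite /N; lia.
rewrite -big_split/= [leRHS]big_split_ord/= -[leLHS]addr0.
have B0 i j : 0 <= B1 i j + B2 i j.
  have := mulr_ge0 (n0 i) (n0 j).
  by rewrite /B1 /B2; do 4?[case: ifP => _]; rewrite ?addr0 ?add0r// => ?; rewrite addr_ge0.
apply: lerD; last first.
  by apply: sumr_ge0 => i _; rewrite -big_split/=; apply: sumr_ge0 => j _.
apply: ler_sum => i _; rewrite -big_split/=; apply: ler_sum => j _.
case: ifP => // ij; rewrite /Gb; case: ifP => // IJ.
have nn := mulr_ge0 (n0 i) (n0 j).
have := ltn_ord i; have := ltn_ord j; move: IJ; rewrite /I /B1 /B2 => IJ jN iN.
have [ir|ir] := ltnP i r.
  have -> : (r <= j < r + r)%N by lia.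
  by rewrite lerDl; do 2?[case: ifP => _].
have -> : (L <= i < L + r)%N by lia.
have -> : (r + L <= j < r + L + r)%N by lia.
by rewrite add0r.
Qed.

Lemma EnN_pert M x z (s q : nat) t :
  0 <= t -> (forall i, x i <= z i) -> z s = x s ->
  (s < q <= s + r)%N && (s < M)%N || (q < s <= q + r)%N && (q < M)%N ->
  EnN M (fun i => z i + (i == s)%:R * t) <=
  EnN M z + 2 * r%:R * kap * t ^+ 2
  - (EnN M (fun i => x i - (i == s)%:R * t) - EnN M x)
  - lam * t * (z q - x q).
Proof.
move=> t0 xz zs sq.
pose c i j : R := (i == s)%:R + (j == s)%:R.
pose g i j : R := (i == s)%:R * (z j - x j) + (j == s)%:R * (z i - x i).
have H1 : EnN M (fun i => z i + (i == s)%:R * t) <=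
  EnN M z + kap * t ^+ 2 * (\sum_(i < M) \sum_(k < r) c i (i + k.+1)%N)
  - (EnN M (fun i => x i - (i == s)%:R * t) - EnN M x)
  - lam * t * (\sum_(i < M) \sum_(k < r) g i (i + k.+1)%N).
  rewrite /EnN !mulr_sumr -!sumrB -big_split/= -!sumrB; apply: ler_sum => i _.
  rewrite !mulr_sumr -!sumrB -big_split/= -!sumrB; apply: ler_sum => k _.
  apply: pair_pert => //.
  - by apply/negP => /andP[/eqP e1 /eqP]; lia.
  - by move=> /eqP ->.
  - by move=> /eqP ->.
apply: le_trans H1 _.
have Hc : \sum_(i < M) \sum_(k < r) c i (i + k.+1)%N <= 2 * r%:R.
  rewrite exchange_big/= (@le_trans _ _ (\sum_(k < r) (1 + 1)))//; last first.
    by rewrite sumr_const card_ord -mulr_natr; lra.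
  apply: ler_sum => k _; rewrite big_split/= lerD ?sum_eqn_le//.
  rewrite (eq_bigr (fun i : 'I_M => ((i + 0)%N == s)%:R)) ?sum_eqn_le// => i _.
  by rewrite addn0.
have g0 i j : 0 <= g i j by rewrite addr_ge0// mulr_ge0// subr_ge0.
have Hg : z q - x q <= \sum_(i < M) \sum_(k < r) g i (i + k.+1)%N.
  have key i j : (i < j <= i + r)%N -> (i < M)%N ->
      g i j <= \sum_(i < M) \sum_(k < r) g i (i + k.+1)%N.
    move=> ij iM; have kr : (j - i.+1 < r)%N by lia.
    rewrite (bigD1 (Ordinal iM))//= (bigD1 (Ordinal kr))//=.
    have -> : (i + (j - i.+1).+1)%N = j by lia.
    rewrite -addrA lerDl addr_ge0 ?sumr_ge0// => a _; exact: sumr_ge0.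
  case/orP: sq => /andP[h1 h2].
    apply: le_trans (key _ _ h1 h2); rewrite /g eqxx mul1r lerDl mulr_ge0//.
    by rewrite subr_ge0.
  apply: le_trans (key _ _ h1 h2); rewrite /g eqxx mul1r lerDr mulr_ge0//.
  by rewrite subr_ge0.
have := ler_wpM2l (mulr_ge0 kap_ge0 (exprn_ge0 2 t0)) Hc.
have := ler_wpM2l (mulr_ge0 lam_ge0 t0) Hg.
lra.
Qed.

Definition En (o : int) (M : nat) (x : int -> R) : R := EnN M (shift x o).

(* En o M counts every pair of sites at distance at most r that meets the window
   [o + r, o + M), which is empty when M <= r. *)
Definition gmin (x : int -> R) : Prop :=
  forall o M v, (forall i, ~~ (o + r%:Z <= i < o + M%:Z) -> v i = x i) ->
  En o M x <= En o M v.

Definition swapZ (a : int) (L : nat) (x y : int -> R) (i : int) : R :=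
  if (x i < y i) && (a <= i < a + L%:Z) then y i else x i.
Definition swapZ' (a : int) (L : nat) (x y : int -> R) (i : int) : R :=
  if (x i < y i) && (a <= i < a + L%:Z) then x i else y i.

Lemma En_swap (a : int) L (x y : int -> R) (n := gapZ x y) (p := gapZ y x) :
  En (a - r%:Z) (r + L) (swapZ a L x y) + En (a - r%:Z) (r + L) (swapZ' a L x y) <=
  En (a - r%:Z) (r + L) x + En (a - r%:Z) (r + L) y
  - lam * cross r n p a L + kap * (flux r n a + flux r n (a + L%:Z)).
Proof.
have := EnN_swap L (shift x (a - r%:Z)) (shift y (a - r%:Z)).
have e1 : swapN L (shift x (a - r%:Z)) (shift y (a - r%:Z)) =
    shift (swapZ a L x y) (a - r%:Z).
  apply: funext => i; rewrite /swapN /shift /swapZ.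
  by have -> : (a <= a - r%:Z + i%:Z < a + L%:Z) = (r <= i < r + L)%N by lia.
have e2 : swapN' L (shift x (a - r%:Z)) (shift y (a - r%:Z)) =
    shift (swapZ' a L x y) (a - r%:Z).
  apply: funext => i; rewrite /swapN' /shift /swapZ'.
  by have -> : (a <= a - r%:Z + i%:Z < a + L%:Z) = (r <= i < r + L)%N by lia.
rewrite e1 e2 -/(En _ _ _) -/(En _ _ _).
have sh (w : int -> R) i : shift w (a - r%:Z) (r + i)%N = shift w a i.
  by rewrite /shift; congr w; lia.
rewrite -[fun i => gap (shift x _ i) _]/(shift n (a - r%:Z)).
rewrite -[fun i => gap (shift y _ i) _]/(shift p (a - r%:Z)); cbv zeta.
have -> : (fun i => shift n (a - r%:Z) (r + i)%N) = shift n a by exact: funext.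
have -> : (fun i => shift p (a - r%:Z) (r + i)%N) = shift p a by exact: funext.
rewrite !winN_shift /flux.
have -> : a - r%:Z + r%:Z = a by lia.
have -> : a - r%:Z + 0%:Z = a - r%:Z by lia.
have -> : a - r%:Z + L%:Z = a + L%:Z - r%:Z by lia.
by have -> : a - r%:Z + (r + L)%:Z = a + L%:Z by lia.
Qed.

Lemma cross_le_flux (a : int) L (x y : int -> R) : gmin x ->
  En (a - r%:Z) (r + L) y <= En (a - r%:Z) (r + L) (swapZ' a L x y) ->
  lam * cross r (gapZ x y) (gapZ y x) a L <=
  kap * (flux r (gapZ x y) a + flux r (gapZ x y) (a + L%:Z)).
Proof.
move=> gx gy; have := En_swap a L x y; cbv zeta.
have := gx (a - r%:Z) (r + L)%N (swapZ a L x y).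
have H : forall i, ~~ (a - r%:Z + r%:Z <= i < a - r%:Z + (r + L)%N%:Z) ->
    swapZ a L x y i = x i.
  move=> i hi; rewrite /swapZ; have -> : (a <= i < a + L%:Z) = false by lia.
  by rewrite andbF.
by move=> /(_ H); lra.
Qed.

End Energy.

Lemma int_step (P : int -> bool) (a b : int) : P a -> ~~ P b ->
  exists q s : int, [/\ P q, ~~ P s & s = q + 1 \/ q = s + 1].
Proof.
have H (Q : int -> bool) (c : int) (m : nat) : Q c -> ~~ Q (c + m%:Z) ->
    exists q : int, Q q /\ ~~ Q (q + 1).
  elim: m c => [|m IH] c Qc nQ; first by rewrite addr0 Qc in nQ.
  have [Qc1|nQc1] := boolP (Q (c + 1)); last by exists c.
  by apply: (IH (c + 1)) => //; rewrite (_ : _ + _ = c + m.+1%:Z)//; lia.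
move=> Pa nPb; have [ab|ba] := leP a b.
  have [|q [h1 h2]] := H P a `|b - a|%N Pa; last by exists q, (q + 1); split; auto.
  by rewrite (_ : a + _ = b)//; lia.
have [|q [h1 h2]] := H (fun i => ~~ P i) b `|a - b|%N nPb.
  by rewrite (_ : b + _ = a) ?negbK//; lia.
by exists (q + 1), q; split; auto; rewrite negbK in h2.
Qed.

Section Strict.
Context {R : realType} {r : nat} (lam kap : R) (F : 'I_r -> R -> R -> R).
Hypotheses (r_gt0 : (0 < r)%N) (lam_gt0 : 0 < lam) (kap_gt0 : 0 < kap).
Hypothesis FP : forall k, twist_pot lam kap (F k).
Implicit Types x y z : int -> R.

Lemma En_pert (o : int) M x z (s q : int) t :
  0 <= t -> (forall i, x i <= z i) -> z s = x s -> o <= s < o + M%:Z ->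
  o <= q < o + M%:Z -> s = q + 1 \/ q = s + 1 ->
  En F o M (fun i => z i + (i == s)%:R * t) <=
  En F o M z + 2 * r%:R * kap * t ^+ 2
  - (En F o M (fun i => x i - (i == s)%:R * t) - En F o M x)
  - lam * t * (z q - x q).
Proof.
move=> t0 xz zs so qo sq.
pose s' := `|s - o|%N; pose q' := `|q - o|%N.
have := @EnN_pert _ _ _ _ _ (ltW lam_gt0) (ltW kap_gt0) FP M (shift x o) (shift z o)
  s' q' t t0.
have es : o + s'%:Z = s by rewrite /s'; lia.
have eq : o + q'%:Z = q by rewrite /q'; lia.
have ei (i : nat) : (i == s') = (o + i%:Z == s) by rewrite /s'; lia.
have -> : (fun i => shift z o i + (i == s')%:R * t) =
   shift (fun i => z i + (i == s)%:R * t) o.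
  by apply: funext => i; rewrite /shift ei.
have -> : (fun i => shift x o i - (i == s')%:R * t) =
   shift (fun i => x i - (i == s)%:R * t) o.
  by apply: funext => i; rewrite /shift ei.
have fold w : EnN F M (shift w o) = En F o M w by [].
rewrite !fold /shift es eq; apply => //.
rewrite /s' /q'; lia.
Qed.

Lemma crossing_cost x y (p q : int) : gmin F x -> x q < y q -> y p < x p ->
  exists (delta : R) (A : nat), 0 < delta /\ forall (a : int) L, a <= - A%:Z -> A%:Z <= a + L%:Z ->
  En F (a - r%:Z) (r + L) y <= En F (a - r%:Z) (r + L) (swapZ' a L x y) ->
  delta <= flux r (gapZ x y) a + flux r (gapZ x y) (a + L%:Z).
Proof.
move=> gx xyq yxp.
have [||{xyq}q [s [xyq yxs sq]]] := @int_step (fun i => x i < y i) q p => //.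
  by rewrite -leNgt ltW.
rewrite -leNgt in yxs.
pose A := (`|q|%N + `|s|%N + 1)%N.
have nn (u v : int -> R) (c : int) i : 0 <= shift (gapZ u v) c i by exact: gap_ge0.
suff [delta [delta0 H]] : exists delta : R, 0 < delta /\ forall (a : int) L, a <= - A%:Z ->
    A%:Z <= a + L%:Z ->
    En F (a - r%:Z) (r + L) y <= En F (a - r%:Z) (r + L) (swapZ' a L x y) ->
    delta <= kap * (flux r (gapZ x y) a + flux r (gapZ x y) (a + L%:Z)).
  exists (delta / kap), A; split; first by rewrite divr_gt0.
  by move=> a L h1 h2 h3; rewrite ler_pdivrMr// mulrC; exact: H.
move: yxs; rewrite le_eqVlt => /orP[/eqP yxs|yxs]; last first.
  exists (lam * (gapZ x y q * gapZ y x s)); split.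
    by rewrite /gapZ !mulr_gt0 ?gap_gt0.
  move=> a L aA AL gy; have := cross_le_flux (ltW lam_gt0) (ltW kap_gt0) FP gx gy.
  apply: le_trans; rewrite ler_pM2l//.
  have := @crossN_term _ r _ _ (nn x y a) (nn y x a) L `|q - a|%N `|s - a|%N.
  rewrite /shift.
  have -> : a + `|q - a|%N%:Z = q by rewrite /A in aA; lia.
  have -> : a + `|s - a|%N%:Z = s by rewrite /A in aA; lia.
  by apply; rewrite /A in aA AL; lia.
(* Raising the exchanged sequence by t at s costs at most 2 r kap t^2, because x is
   minimal and equals y there, and gains lam t g from the pair of s and q. *)
pose g := y q - x q; have g0 : 0 < g by rewrite subr_gt0.
have r0 : 0 < r%:R :> R by rewrite ltr0n.
pose t := lam * g / (4 * r%:R * kap).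
have t0 : 0 < t by rewrite divr_gt0 ?mulr_gt0 ?mulr_gt0.
exists (lam * t * g / 2); split; first by apply: divr_gt0 => //; do 2?apply: mulr_gt0.
move=> a L aA AL gy.
have et : 2 * r%:R * kap * t ^+ 2 = lam * t * g / 2.
  by rewrite /t; field; rewrite ?gt_eqF.
have sL : a <= s < a + L%:Z by rewrite /A in aA AL; lia.
have qL : a <= q < a + L%:Z by rewrite /A in aA AL; lia.
have so : a - r%:Z <= s < a - r%:Z + (r + L)%N%:Z by lia.
have qo : a - r%:Z <= q < a - r%:Z + (r + L)%N%:Z by lia.
pose z := swapZ a L x y.
have xz i : x i <= z i.
  by rewrite /z /swapZ; case: ifP => // /andP[/ltW].
have zs : z s = x s by rewrite /z /swapZ yxs; case: ifP.
have zq : z q = y q by rewrite /z /swapZ xyq qL.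
have := @En_pert (a - r%:Z) (r + L)%N x z s q t (ltW t0) xz zs.
rewrite zq -/g => /(_ so qo sq); rewrite et.
have := En_swap (ltW lam_gt0) (ltW kap_gt0) FP a L x y; cbv zeta.
have : 0 <= cross r (gapZ x y) (gapZ y x) a L by exact: crossN_ge0.
move/(mulr_ge0 (ltW lam_gt0)).
have := gx (a - r%:Z) (r + L)%N (fun i => z i + (i == s)%:R * t).
have := gx (a - r%:Z) (r + L)%N (fun i => x i - (i == s)%:R * t).
have H1 : forall i, ~~ (a - r%:Z + r%:Z <= i < a - r%:Z + (r + L)%N%:Z) ->
    x i - (i == s)%:R * t = x i.
  move=> i hi; have -> : (i == s) = false by lia.
  by rewrite mulr0n mul0r subr0.
have H2 : forall i, ~~ (a - r%:Z + r%:Z <= i < a - r%:Z + (r + L)%N%:Z) ->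
    z i + (i == s)%:R * t = x i.
  move=> i hi; have -> : (i == s) = false by lia.
  rewrite mulr0n mul0r addr0 /z /swapZ; have -> : (a <= i < a + L%:Z) = false by lia.
  by rewrite andbF.
move=> /(_ H1) h1 /(_ H2) h2 h3 h4 h5.
by move: gy h1 h2 h4 h5; rewrite -/z; clear -h3; lra.
Qed.

End Strict.

(** * Periodic minimizers *)

Section PeriodicSequences.
Context {R : realType}.
Implicit Types (v w : int -> R) (G : set R).

Definition per (q : nat) (p : int) v : Prop := forall i, v (i + q%:Z) = v i + p%:~R.
Definition incr_in G v : Prop := forall i, G (v (i + 1) - v i).

Definition vmax v w (i : int) : R := Num.max (v i) (w i).
Definition vmin v w (i : int) : R := Num.min (v i) (w i).

Lemma incr_in_max G v w : is_interval G -> incr_in G v -> incr_in G w ->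
  incr_in G (vmax v w).
Proof.
move=> iG Gv Gw i; rewrite /vmax; move: (Gv i) (Gw i).
have [h|h] := leP (v i) (w i); have [h'|h'] := leP (v (i + 1)) (w (i + 1)) => // gv gw.
  by apply: (iG _ _ gw gv); apply/andP; split; lra.
by apply: (iG _ _ gv gw); apply/andP; split; lra.
Qed.

Lemma incr_in_min G v w : is_interval G -> incr_in G v -> incr_in G w ->
  incr_in G (vmin v w).
Proof.
move=> iG Gv Gw i; rewrite /vmin; move: (Gv i) (Gw i).
have [h|h] := leP (v i) (w i); have [h'|h'] := leP (v (i + 1)) (w (i + 1)) => // gv gw.
  by apply: (iG _ _ gw gv); apply/andP; split; lra.
by apply: (iG _ _ gv gw); apply/andP; split; lra.
Qed.

Lemma perM (q m : nat) p v : per q p v -> per (m * q) (m%:Z * p) v.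
Proof.
move=> pv; elim: m => [|m IH] i; first by rewrite mul0n mul0r !addr0.
have -> : i + (m.+1 * q)%N%:Z = (i + q%:Z) + (m * q)%N%:Z by lia.
by rewrite IH pv -addrA -intrD; congr (_ + _%:~R); lia.
Qed.

Definition periodize (o : int) (M : nat) (p : int) v (i : int) : R :=
  v (o + ((i - o) %% M)%Z) + (((i - o) %/ M)%Z * p)%:~R.

Lemma periodize_id o M p v i : o <= i < o + M%:Z -> periodize o M p v i = v i.
Proof.
move=> h; rewrite /periodize divz_small ?modz_small ?mul0r ?addr0; try lia.
by congr v; lia.
Qed.

Lemma periodize_per o (M : nat) p v : (0 < M)%N -> per M p (periodize o M p v).
Proof.
move=> M0 i; rewrite /periodize.
have -> : i + M%:Z - o = 1 * M%:Z + (i - o) by lia.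
by rewrite modzMDl divzMDl ?eqz_nat -?lt0n//; rewrite mulrDl mul1r intrD; ring.
Qed.

Lemma int_window (M : nat) (P : int -> Prop) (o : int) : (0 < M)%N ->
  (forall i, P i <-> P (i + M%:Z)) -> (forall i, o <= i < o + M%:Z -> P i) ->
  forall i, P i.
Proof.
move=> M0 PM Pw i.
have H (c : int) (m : nat) : P c <-> P (c + (m * M)%N%:Z).
  elim: m c => [|m IH] c; first by rewrite mul0n addr0.
  rewrite (_ : c + (m.+1 * M)%N%:Z = (c + M%:Z) + (m * M)%N%:Z); last lia.
  by rewrite -IH; exact: PM.
have M0' : M%:Z != 0 by rewrite eqz_nat -lt0n.
have h1 := modz_ge0 (i - o) M0'.
have h2 : ((i - o) %% M)%Z < M%:Z by rewrite ltz_pmod// ltz_nat.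
have h3 := divz_eq (i - o) M%:Z.
have Pm : P (o + ((i - o) %% M)%Z) by apply: Pw; lia.
set k := ((i - o) %/ M)%Z in h3; set l := ((i - o) %% M)%Z in h1 h2 h3 Pm.
have [k0|k0] := leP 0 k.
  have := (H (o + l) `|k|%N).1 Pm; congr P.
  by rewrite PoszM gez0_abs//; lia.
apply/(H i `|k|%N); move: Pm; congr P.
by rewrite PoszM lez0_abs ?ltW//; lia.
Qed.

End PeriodicSequences.

Section PeriodicEnergy.
Context {R : realType} {r : nat} (lam kap : R) (F : 'I_r -> R -> R -> R).
Implicit Types v w : int -> R.

Lemma En_cat o M1 M2 v : En F o (M1 + M2) v = En F o M1 v + En F (o + M1%:Z) M2 v.
Proof.
rewrite /En /EnN big_split_ord/=; congr (_ + _); apply: eq_bigr => i _.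
by apply: eq_bigr => k _; rewrite /shift; congr F; congr v; lia.
Qed.

Lemma eq_En o M v w : (forall i, o <= i < o + M%:Z + r%:Z -> v i = w i) ->
  En F o M v = En F o M w.
Proof.
move=> vw; rewrite /En /EnN; apply: eq_bigr => i _; apply: eq_bigr => k _; rewrite /shift.
by have := ltn_ord i; have := ltn_ord k => ? ?; rewrite !vw//; lia.
Qed.

Lemma En_shift o M v (c : int) : En F o M (fun i => v (i + c)) = En F (o + c) M v.
Proof.
rewrite /En /EnN; apply: eq_bigr => i _; apply: eq_bigr => k _.
by rewrite /shift; congr F; congr v; lia.
Qed.

Hypothesis FP : forall k, twist_pot lam kap (F k).

Lemma potential_addz k a b (p : int) : F k (a + p%:~R) (b + p%:~R) = F k a b.
Proof.
have [per1 _ _ _ _] := FP k.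
have H a' b' (m : nat) : F k (a' + m%:R) (b' + m%:R) = F k a' b'.
  by elim: m => [|m IH]; rewrite ?addr0// -natr1 !addrA per1.
by case: p => m; rewrite -?pmulrn ?H// NegzE mulrNz -(H _ _ m.+1) !pmulrn !subrK.
Qed.

Lemma En_addz o M v (p : int) : En F o M (fun i => v i + p%:~R) = En F o M v.
Proof.
rewrite /En /EnN; apply: eq_bigr => i _; apply: eq_bigr => k _.
by rewrite /shift potential_addz.
Qed.

Lemma En_per o M q p v : per q p v -> En F (o + q%:Z) M v = En F o M v.
Proof.
move=> pv; rewrite -En_shift -[RHS](En_addz _ _ _ p).
by apply: eq_En => i _; rewrite pv.
Qed.

Lemma En_per_base o o' q p v : per q p v -> En F o q v = En F o' q v.
Proof.
move=> pv.
have step c : En F (c + 1) q v = En F c q v.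
  have := En_cat c 1 q v; rewrite addnC En_cat (En_per _ _ pv) addrC.
  by move/addrI => ->.
have H c (m : nat) : En F (c + m%:Z) q v = En F c q v.
  elim: m => [|m IH]; first by rewrite addr0.
  by rewrite -IH -(step (c + m%:Z)); congr (En F _ q v); lia.
have [h|h] := leP o o'.
  by rewrite -(H o `|o' - o|%N); congr (En F _ q v); lia.
by rewrite -(H o' `|o - o'|%N); congr (En F _ q v); lia.
Qed.

Lemma En_perM o q p v m : per q p v -> En F o (m * q) v = m%:R * En F o q v.
Proof.
move=> pv; elim: m => [|m IH]; first by rewrite mul0n mul0r /En /EnN big_ord0.
by rewrite mulSn En_cat (En_per _ _ pv) IH -natr1; ring.
Qed.

Hypothesis lam_ge0 : 0 <= lam.

Lemma En_maxmin o M v w :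
  En F o M (vmax v w) + En F o M (vmin v w) <= En F o M v + En F o M w.
Proof.
rewrite -!big_split/=; apply: ler_sum => i _.
rewrite -!big_split/=; apply: ler_sum => k _; rewrite /shift /vmax /vmin.
have [_ mix _ _ _] := FP k.
set a := v _; set a' := w _; set b := v _; set b' := w _.
have [ha|ha] := leP a a'; have [hb|hb] := leP b b'; try lra.
- have /andP[+ _] := mix _ _ _ _ ha (ltW hb).
  by have := mulr_ge0 lam_ge0 (mulr_ge0 (_ : 0 <= a' - a) (_ : 0 <= b - b'));
     rewrite !subr_ge0 ha (ltW hb) => /(_ isT isT); lra.
- have /andP[+ _] := mix _ _ _ _ (ltW ha) hb.
  by have := mulr_ge0 lam_ge0 (mulr_ge0 (_ : 0 <= a - a') (_ : 0 <= b' - b));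
     rewrite !subr_ge0 hb (ltW ha) => /(_ isT isT); lra.
Qed.

Definition per_lower_bound (G : set R) (q : nat) (p : int) (E : R) : Prop :=
  forall v, per q p v -> incr_in G v -> E <= En F 0 q v.

(* For a (2q,2p)-periodic v the maximum and minimum of v and its (q,p)-translate
   are (q,p)-periodic, and together they have at most the energy of v and its translate. *)
Lemma per_lower_bound_double G q p E : is_interval G ->
  per_lower_bound G q p E -> per_lower_bound G (2 * q) (2 * p) (2 * E).
Proof.
move=> iG H v pv Gv.
pose v' i := v (i + q%:Z) - p%:~R.
have pv' i : v' (i + q%:Z) = v i + p%:~R.
  rewrite /v' -addrA -PoszD addnn -mul2n pv mulrDl !mul1r intrD; ring.
have Gv' : incr_in G v'.
  move=> i; rewrite /v'; have -> : i + 1 + q%:Z = i + q%:Z + 1 by lia.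
  by have := Gv (i + q%:Z); congr G; ring.
have ev : En F 0 (2 * q) v' = En F 0 (2 * q) v.
  have -> : v' = (fun i => v (i + q%:Z) + (- p)%:~R).
    by apply: funext => i; rewrite mulrNz.
  rewrite En_addz En_shift mul2n -addnn !En_cat.
  have -> : 0 + q%:Z + q%:Z = 0 + (2 * q)%N%:Z by lia.
  by rewrite (En_per 0 q pv) addrC.
have pmax : per q p (vmax v v').
  by move=> i; rewrite /vmax pv' addr_maxl maxC /v' subrK.
have pmin : per q p (vmin v v').
  by move=> i; rewrite /vmin pv' addr_minl minC /v' subrK.
have := En_maxmin 0 (2 * q) v v'; rewrite ev.
rewrite (En_perM 0 2 pmax) (En_perM 0 2 pmin).
have := H _ pmax (incr_in_max iG Gv Gv'); have := H _ pmin (incr_in_min iG Gv Gv').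
lra.
Qed.

Lemma per_lower_bound_pow G q p E m : is_interval G -> per_lower_bound G q p E ->
  per_lower_bound G (2 ^ m * q) ((2 ^ m)%N%:Z * p) ((2 ^ m)%N%:R * E).
Proof.
move=> iG H; elim: m => [|m IH]; first by rewrite expn0 mul1n !mul1r.
have := per_lower_bound_double iG IH.
by rewrite !expnS natrM PoszM !mulrA mulnA.
Qed.

Lemma per_minimizer_compact G q p w (o : int) (m : nat) v (M := (2 ^ m * q)%N) :
  is_interval G -> (0 < r)%N -> (r <= M)%N ->
  per q p w -> per_lower_bound G q p (En F 0 q w) -> incr_in G v ->
  (forall i, ~~ (o + r%:Z <= i < o + M%:Z) -> v i = w i) ->
  En F o M w <= En F o M v.
Proof.
move=> iG r0 rM pw Hw Gv vw.
have M0 : (0 < M)%N by lia.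
pose P := (2 ^ m)%N%:Z * p.
have pwM : per M P w by exact: perM.
pose v' := periodize o M P v.
have pv' : per M P v' by exact: periodize_per.
have vv' i : o <= i < o + M%:Z + r%:Z -> v' i = v i.
  move=> hi; have [iM|iM] := ltP i (o + M%:Z); first by apply: periodize_id; lia.
  have -> : i = (i - M%:Z) + M%:Z by lia.
  rewrite pv' /v' periodize_id; last by lia.
  by rewrite !vw ?pwM//; lia.
have Gv' : incr_in G v'.
  apply: (@int_window M (fun i => G (v' (i + 1) - v' i)) o M0).
    move=> i; have -> : i + M%:Z + 1 = i + 1 + M%:Z by lia.
    by rewrite !pv'; have -> : v' (i + 1) + P%:~R - (v' i + P%:~R) = v' (i + 1) - v' i by ring.
  by move=> i hi; rewrite !vv'//; lia.
have := per_lower_bound_pow (m := m) iG Hw pv' Gv'.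
rewrite -(eq_En vv') (En_per_base o 0 pv').
by rewrite (En_perM o _ pw) (En_per_base o 0 pw).
Qed.

End PeriodicEnergy.

Section Continuity.
Local Open Scope classical_set_scope.
Context {R : realType} (lam kap : R) (f : R -> R -> R).
Hypotheses (lam_ge0 : 0 <= lam) (kap_gt0 : 0 < kap) (fP : twist_pot lam kap f).

Lemma twist_mixed_le a a' b b' :
  `|f a' b + f a b' - f a' b' - f a b| <= kap * (`|a' - a| * `|b' - b|).
Proof.
have [_ mix _ _ _] := fP.
have H x x' y y' : x <= x' -> y <= y' ->
    `|f x' y + f x y' - f x' y' - f x y| <= kap * ((x' - x) * (y' - y)).
  move=> xx yy; have /andP[h1 h2] := mix _ _ _ _ xx yy; rewrite ger0_norm//.
  by apply: le_trans h1; rewrite !mulr_ge0// subr_ge0.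
have [aa|/ltW aa] := leP a a'; have [bb|/ltW bb] := leP b b'.
- rewrite (ger0_norm (_ : 0 <= a' - a)) ?subr_ge0//.
  by rewrite (ger0_norm (_ : 0 <= b' - b)) ?subr_ge0//; exact: H.
- rewrite (ger0_norm (_ : 0 <= a' - a)) ?subr_ge0// (distrC b').
  rewrite (ger0_norm (_ : 0 <= b - b')) ?subr_ge0//.
  by apply: le_trans (H _ _ _ _ aa bb); rewrite -normrN le_eqVlt; apply/orP; left;
    apply/eqP; congr `|_|; ring.
- rewrite (ger0_norm (_ : 0 <= b' - b)) ?subr_ge0// (distrC a').
  rewrite (ger0_norm (_ : 0 <= a - a')) ?subr_ge0//.
  by apply: le_trans (H _ _ _ _ aa bb); rewrite -normrN le_eqVlt; apply/orP; left;
    apply/eqP; congr `|_|; ring.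
- rewrite (distrC a') (distrC b').
  rewrite (ger0_norm (_ : 0 <= a - a')) ?subr_ge0//.
  rewrite (ger0_norm (_ : 0 <= b - b')) ?subr_ge0//.
  by apply: le_trans (H _ _ _ _ aa bb); rewrite le_eqVlt; apply/orP; left;
    apply/eqP; congr `|_|; ring.
Qed.

Lemma twist_continuous2 (T : topologicalType) (g h : T -> R) :
  continuous g -> continuous h -> continuous (fun t => f (g t) (h t)).
Proof.
move=> cg ch x; have [_ _ _ _ [c1 c2]] := fP.
set a := g x; set b := h x.
have H1 : f (g t) b @[t --> x] --> f a b by apply: cvg_comp (cg x) (c1 b a).
have H2 : f a (h t) @[t --> x] --> f a b by apply: cvg_comp (ch x) (c2 a b).
apply/cvgrPdist_le => e e0.
have e3 : 0 < e / 3 by rewrite divr_gt0.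
have ek : 0 < e / 3 / kap by rewrite divr_gt0.
near=> t.
have n1 : `|f a b - f (g t) b| <= e / 3 by near: t; move/cvgrPdist_le: H1; exact.
have n2 : `|f a b - f a (h t)| <= e / 3 by near: t; move/cvgrPdist_le: H2; exact.
have n3 : `|a - g t| <= e / 3 / kap.
  by near: t; move/cvgrPdist_le: (cg x); exact.
have n4 : `|b - h t| <= 1 by near: t; move/cvgrPdist_le: (ch x); exact.
have := twist_mixed_le a (g t) b (h t); rewrite [`|g t - a|]distrC [`|h t - b|]distrC.
have := ler_pM (normr_ge0 _) (normr_ge0 _) n3 n4; rewrite mulr1.
rewrite -(ler_pM2l kap_gt0) [kap * (e / 3 / kap)]mulrC divfK ?gt_eqF// => h5 h6.
have {h5 h6} h7 := le_trans h6 h5.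
have -> : f a b - f (g t) (h t) = (f a b - f (g t) b) + (f a b - f a (h t)) +
  (f (g t) b + f a (h t) - f (g t) (h t) - f a b) by ring.
apply: le_trans (ler_normD _ _) _.
have := ler_normD (f a b - f (g t) b) (f a b - f a (h t)); lra.
Unshelve. all: by end_near.
Qed.

End Continuity.

Section Existence.
Local Open Scope classical_set_scope.
Context {R : realType} {r : nat} (lam kap : R) (F : 'I_r -> R -> R -> R).
Hypotheses (lam_ge0 : 0 <= lam) (kap_gt0 : 0 < kap).
Hypothesis FP : forall k, twist_pot lam kap (F k).

Definition per_ext (q : nat) (p : int) (xi : 'rV[R]_q.+1) : int -> R :=
  periodize 0 q.+1 p (fun i => xi 0 (inord `|i|%N)).

Lemma per_extP q p xi : per q.+1 p (@per_ext q p xi).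
Proof. exact: periodize_per. Qed.

Lemma per_ext_row q p v : per q.+1 p v -> per_ext p (\row_(j < q.+1) v j%:Z) = v.
Proof.
move=> pv; apply: funext => i; move: i.
apply: (@int_window q.+1 (fun i => per_ext p (\row_(j < q.+1) v j%:Z) i = v i) 0) => //.
  by move=> i; rewrite per_extP pv; split=> [->//|/addIr].
move=> i hi; rewrite /per_ext periodize_id// mxE inordK; last by lia.
by congr v; lia.
Qed.

Lemma per_ext_continuous q p i : continuous (fun xi : 'rV[R]_q.+1 => per_ext p xi i).
Proof.
move=> xi; rewrite /per_ext /periodize.
exact: cvgD (@coord_continuous R 1 q.+1 _ _ xi) (cvg_cst _).
Qed.

Lemma En_per_ext_continuous q p o M :
  continuous (fun xi : 'rV[R]_q.+1 => En F o M (per_ext p xi)).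
Proof.
have H (n : nat) (g : 'I_n -> 'rV[R]_q.+1 -> R) : (forall i, continuous (g i)) ->
    continuous (fun xi => \sum_(i < n) g i xi).
  elim: n g => [|n IH] g cg.
    have -> : (fun xi => \sum_(i < 0) g i xi) = cst 0.
      by apply: funext => xi; rewrite big_ord0.
    exact: cst_continuous.
  have -> : (fun xi => \sum_(i < n.+1) g i xi) =
      (fun xi => \sum_(i < n) g (widen_ord (leqnSn n) i) xi) \+ g ord_max.
    by apply: funext => xi; rewrite big_ord_recr.
  move=> xi.
  exact: continuousD (IH (fun i => g (widen_ord (leqnSn n) i)) (fun i => cg _) xi) (cg _ xi).
apply: (H _ _) => i; apply: (H _ _) => k; rewrite /shift.
apply: (twist_continuous2 lam_ge0 kap_gt0 (FP k)); exact: per_ext_continuous.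
Qed.

Lemma per_minimizer_exists (q : nat) (p : int) (alpha beta : R) : (0 < q)%N ->
  alpha * q%:R <= p%:~R <= beta * q%:R ->
  let G := [set s : R | alpha <= s <= beta] in
  exists w, [/\ per q p w, incr_in G w & per_lower_bound F G q p (En F 0 q w)].
Proof.
case: q => // q _ /andP[ap pb] G.
pose box := [set xi : 'rV[R]_q.+1 | forall j : 'I_q.+1,
  `[(j%:R * alpha), (1 + j%:R * beta)] (xi ord0 j)].
have cbox : compact box.
  by apply: (@rV_compact _ _ (fun j : 'I_q.+1 => `[(j%:R * alpha), (1 + j%:R * beta)]))
    => j; exact: segment_compact.
pose C := \bigcap_(i in [set: int])
  ((fun xi : 'rV[R]_q.+1 => per_ext p xi (i + 1) - per_ext p xi i) @^-1` `[alpha, beta]).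
have cC : closed C.
  apply: closed_bigI => i _; apply: preimage_closed; last exact: itv_closed.
  move=> xi _.
  exact: continuousB (@per_ext_continuous q p (i + 1) xi) (@per_ext_continuous q p i xi).
have cA : compact (box `&` C) by exact: compact_closedI.
have inA v : per q.+1 p v -> incr_in G v -> 0 <= v 0 <= 1 ->
    (box `&` C) (\row_(j < q.+1) v j%:Z).
  move=> pv Gv v01; split; last first.
    by move=> i _; rewrite /= per_ext_row// in_itv/=; exact: Gv.
  move=> j; rewrite /= mxE in_itv/=.
  suff H (n : nat) : n%:R * alpha <= v n%:Z <= 1 + n%:R * beta by exact: H.
  elim: n => [|n /andP[h1 h2]]; first by rewrite !mul0r addr0.
  have := Gv n%:Z; rewrite /G/= => /andP[h3 h4].
  have -> : n.+1%:Z = n%:Z + 1 by rewrite intS addrC.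
  by rewrite -natr1 !mulrDl !mul1r; apply/andP; split; lra.
have A0 : box `&` C !=set0.
  pose s : R := p%:~R / q.+1%:R.
  exists (\row_(j < q.+1) (fun i : int => s * i%:~R) j%:Z).
  apply: (inA (fun i => s * i%:~R)).
  - by move=> i; rewrite intrD mulrDr; congr (_ + _); rewrite /s -pmulrn divfK.
  - move=> i; rewrite /G/= intrD mulrDr mulr1 addrC addKr /s.
    by rewrite ler_pdivlMr// ler_pdivrMr// ap.
  - by rewrite mulr0 lexx ler01.
have cf : {within box `&` C, continuous (fun xi => En F 0 q.+1 (per_ext p xi))}.
  exact/continuous_subspaceT/En_per_ext_continuous.
have [c cA' cmin] := EVT_min_rV A0 cA cf.
move: cA'; rewrite inE => -[_ Cc].
exists (per_ext p c); split; first exact: per_extP.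
  by move=> i; have := Cc i I; rewrite /= in_itv/=.
move=> v pv Gv; pose m := Num.floor (v 0).
pose v' i := v i + (- m)%:~R.
have pv' : per q.+1 p v' by move=> i; rewrite /v' pv addrAC.
have Gv' : incr_in G v'.
  by move=> i; rewrite /v' opprD addrACA subrr addr0; exact: Gv.
have v01 : 0 <= v' 0 <= 1.
  rewrite /v' intrN subr_ge0 lerBlDr ge_floor/= ltW//.
  by have := floorD1_gt (v 0); rewrite intrD addrC.
have := inA _ pv' Gv' v01; rewrite -inE => /cmin; rewrite per_ext_row//.
by rewrite /v' (En_addz FP).
Qed.

End Existence.

(** * Local energies *)

Section OneVariable.
Local Open Scope classical_set_scope.
Context {R : realType}.

Lemma mean_value (f df : R -> R) (a b : R) :
  (forall x : R, is_derive x 1 f (df x)) -> a <= b ->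
  exists c, f b - f a = df c * (b - a).
Proof.
move=> fd ab; have [|c _ e] := @MVT_segment R f df a b ab (fun x _ => fd x); last by exists c.
by apply: derivable_within_continuous => x _; have := fd x => -[].
Qed.

Lemma second_difference_le (f df ddf : R -> R) (kap a t : R) :
  (forall x : R, is_derive x 1 f (df x)) -> (forall x : R, is_derive x 1 df (ddf x)) ->
  (forall x, ddf x <= kap) -> f (a + t) + f (a - t) - 2 * f a <= kap * t ^+ 2.
Proof.
move=> fd dfd bnd; wlog t0 : t / 0 <= t.
  move=> H; have [/H//|/ltW t0] := leP 0 t.
  by have := H (- t); rewrite oppr_ge0 opprK sqrrN addrAC => /(_ t0); lra.
pose g x := f x - f (x - t).
have gd (x : R) : is_derive x 1 g (df x - df (x - t)).
  have h : is_derive x 1 (fun x : R => x - t) (1 : R).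
    rewrite -[X in is_derive _ _ _ X]subr0.
    exact: is_deriveB (is_derive_id x 1) (is_derive_cst t x 1).
  have h1 : is_derive x 1 (fun x : R => f (x - t)) (df (x - t)).
    by have := @is_derive1_comp R f (fun x => x - t) x _ _ (fd (x - t)) h; rewrite mulr1.
  exact: is_deriveB (fd x) h1.
have [|c hc] := mean_value gd (_ : a <= a + t); first by rewrite lerDl.
have [|e he] := mean_value dfd (_ : c - t <= c); first by rewrite gerBl.
have : f (a + t) + f (a - t) - 2 * f a = ddf e * t ^+ 2.
  transitivity (g (a + t) - g a); first by rewrite /g addrK; ring.
  by rewrite hc he; ring.
by move=> ->; rewrite ler_wpM2r// exprn_ge0.
Qed.

End OneVariable.

Section TwoVariables.
Local Open Scope classical_set_scope.
Context {R : realType}.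
Implicit Type f : 'rV[R]_2 -> R.

Lemma pt_addl (h a b : R) : h *: delta_mx 0 ord0 + pt a b = pt (h + a) b.
Proof.
apply/rowP => k; rewrite !mxE; case: k => [[|[|k]] hk] //=.
  by rewrite mulr1.
by rewrite mulr0 add0r.
Qed.

Lemma pt_addr (h a b : R) : h *: delta_mx 0 ord_max + pt a b = pt a (h + b).
Proof.
apply/rowP => k; rewrite !mxE; case: k => [[|[|k]] hk] //=.
  by rewrite mulr0 add0r.
by rewrite mulr1.
Qed.

Lemma is_derive_ptl f (a b : R) : derivable f (pt a b) (delta_mx 0 ord0) ->
  is_derive a 1 (fun a => f (pt a b)) (partial ord0 f (pt a b)).
Proof.
have e : (fun h : R => h^-1 *: (f (h *: delta_mx 0 ord0 + pt a b) - f (pt a b))) =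
   (fun h : R => h^-1 *: (f (pt (h *: (1 : R) + a) b) - f (pt a b))).
  by apply: funext => h; rewrite pt_addl -[h *: 1]/(h * 1) mulr1.
by move=> fd; apply: DeriveDef; rewrite ?/partial ?/derive /derivable -?e.
Qed.

Lemma is_derive_ptr f (a b : R) : derivable f (pt a b) (delta_mx 0 ord_max) ->
  is_derive b 1 (fun b => f (pt a b)) (partial ord_max f (pt a b)).
Proof.
have e : (fun h : R => h^-1 *: (f (h *: delta_mx 0 ord_max + pt a b) - f (pt a b))) =
   (fun h : R => h^-1 *: (f (pt a (h *: (1 : R) + b)) - f (pt a b))).
  by apply: funext => h; rewrite pt_addr -[h *: 1]/(h * 1) mulr1.
by move=> fd; apply: DeriveDef; rewrite ?/partial ?/derive /derivable -?e.
Qed.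

Lemma pair_potential_twist r (K lam : R) f : pair_potential r K lam f ->
  twist_pot lam (K / r%:R) (fun a b => f (pt a b)).
Proof.
move=> [[C1f C2f] fper bnd _ tw].
have d0 a b := is_derive_ptl ((C1f ord0).1 (pt a b)).
have d1 a b := is_derive_ptr ((C1f ord_max).1 (pt a b)).
have d00 a b := is_derive_ptl ((C2f ord0 ord0).1 (pt a b)).
have d11 a b := is_derive_ptr ((C2f ord_max ord_max).1 (pt a b)).
have d01 a b := is_derive_ptl ((C2f ord_max ord0).1 (pt a b)).
split=> //.
- move=> a a' b b' aa bb.
  pose g s := f (pt a' s) - f (pt a s).
  have gd (s : R) : is_derive s 1 g (partial ord_max f (pt a' s) - partial ord_max f (pt a s)).
    by apply: is_deriveB.
  have [c hc] := mean_value gd bb.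
  have [e he] := mean_value (fun s => d01 s c) aa.
  have -> : f (pt a' b) + f (pt a b') - f (pt a' b') - f (pt a b) = - (g b' - g b).
    by rewrite /g; ring.
  rewrite hc he.
  set D := partial _ _ _.
  have -> : - (D * (a' - a) * (b' - b)) = - D * ((a' - a) * (b' - b)) by ring.
  have dd : 0 <= (a' - a) * (b' - b) by rewrite mulr_ge0 ?subr_ge0.
  rewrite !ler_wpM2r//.
    by have := bnd ord0 ord_max (pt e c); rewrite ler_norml => /andP[]; rewrite lerNl.
  by rewrite lerNr; exact: tw.
- move=> a b t.
  apply: (second_difference_le a t (fun x => d0 x b) (fun x => d00 x b)) => x.
  by have := bnd ord0 ord0 (pt x b); rewrite ler_norml => /andP[].
- move=> a b t.
  apply: (second_difference_le b t (fun x => d1 a x) (fun x => d11 a x)) => x.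
  by have := bnd ord_max ord_max (pt a x); rewrite ler_norml => /andP[].
- split=> [b|a] x; apply: differentiable_continuous; apply/derivable1_diffP.
    by have := d0 x b => -[].
  by have := d1 a x => -[].
Qed.

End TwoVariables.

Section Bridge.
Local Open Scope classical_set_scope.
Context {R : realType} (r : nat).

Lemma W_interval (S : 'rV[R]_r.+1 -> R) (f : 'I_r -> 'rV[R]_2 -> R) (o : int) M x :
  (forall xi, S xi = \sum_(j < r) f j (pt (xi 0 ord0) (xi 0 (lift ord0 j)))) ->
  W S [set i : int | o <= i < o + M%:Z] x = En (fun k a b => f k (pt a b)) o M x.
Proof.
move=> HS; pose s := [seq o + i%:Z | i <- index_iota 0 M].
have us : uniq s by rewrite map_inj_uniq ?iota_uniq// => i j /addrI [].
have -> : [set i : int | o <= i < o + M%:Z] = [set` s].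
  apply/seteqP; split=> i /=.
    move=> hi; apply/mapP; exists `|i - o|%N; last by lia.
    by rewrite mem_index_iota; lia.
  by move=> /mapP[j]; rewrite mem_index_iota => hj ->; lia.
rewrite /W -fsbig_seq// big_map big_mkord.
apply: eq_bigr => i _; rewrite /energy_at HS; apply: eq_bigr => k _.
by rewrite !mxE /shift/= addr0; congr (f k (pt _ (x _))); rewrite /bump leq0n; lia.
Qed.

Lemma local_energy_twist (K lam : R) (S : 'rV[R]_r.+1 -> R) : local_energy K lam S ->
  exists F : 'I_r -> R -> R -> R, (forall k, twist_pot lam (K / r%:R) (F k)) /\
    forall x, global_minimizer S x -> gmin F x.
Proof.
move=> [_ [f [fP HS]]]; exists (fun k a b => f k (pt a b)); split.
  by move=> k; exact: pair_potential_twist (fP k).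
move=> x mx o M v vx; have [Mr|rM] := leqP M r.
  have -> // : v = x by apply: funext => i; apply: vx; lia.
have H := mx (o + r%:Z) (o + M%:Z - 1).
have := H ltac:(lia) (fun i => v i - x i).
have -> : [set i | o + r%:Z - r%:Z <= i <= o + M%:Z - 1] =
    [set i : int | o <= i < o + M%:Z].
  by apply/seteqP; split=> i /= hi; lia.
have -> : (fun i => x i + (v i - x i)) = v by apply: funext => i; rewrite addrC subrK.
rewrite !(W_interval _ _ _ HS); apply => i hi.
by rewrite vx ?subrr//; lia.
Qed.

End Bridge.

(** * Crossings of translates *)

Section Negation.
Local Open Scope classical_set_scope.
Context {R : realType}.

Lemma twist_pot_neg (lam kap : R) f : twist_pot lam kap f ->
  twist_pot lam kap (fun a b => f (- a) (- b)).
Proof.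
move=> [fper mix sd1 sd2 [c1 c2]]; split.
- by move=> a b; rewrite -(fper (- (a + 1))); congr f; ring.
- move=> a a' b b' aa bb.
  have := mix (- a') (- a) (- b') (- b); rewrite !lerN2 => /(_ aa bb).
  rewrite !opprK (addrC (- a)) (addrC (- b)).
  by move=> /andP[h1 h2]; apply/andP; split; lra.
- by move=> a b t; have := sd1 (- a) (- b) t; rewrite !opprD opprK; lra.
- by move=> a b t; have := sd2 (- a) (- b) t; rewrite !opprD opprK; lra.
- split=> [b|a] x.
    exact: (@cvg_comp _ _ _ -%R (f^~ (- b)) _ _ _ (@opp_continuous _ x) (c1 (- b) (- x))).
  exact: (@cvg_comp _ _ _ -%R (f (- a)) _ _ _ (@opp_continuous _ x) (c2 (- a) (- x))).
Qed.

Lemma gmin_neg r (F : 'I_r -> R -> R -> R) x : gmin F x ->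
  gmin (fun k a b => F k (- a) (- b)) (fun i => - x i).
Proof.
move=> gx o M v vx.
have e w : En (fun k a b => F k (- a) (- b)) o M w = En F o M (fun i => - w i) by [].
rewrite !e; under [in leLHS]eq_fun do rewrite opprK.
by apply: gx => i hi; rewrite vx// opprK.
Qed.

End Negation.

Section Translation.
Local Open Scope classical_set_scope.
Context {R : realType} {r : nat} (lam kap : R) (F : 'I_r -> R -> R -> R).
Hypothesis FP : forall k, twist_pot lam kap (F k).

Lemma gmin_translate x (k l : int) : gmin F x -> gmin F (translate k l x).
Proof.
move=> gx o M v vx.
have e w : En F o M (fun i => w (i - k) + l%:~R) = En F (o - k) M w.
  by rewrite (En_addz FP) (En_shift F o M w (- k)).
pose v' j := v (j + k) - l%:~R.
have -> : v = (fun i => v' (i - k) + l%:~R).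
  by apply: funext => i; rewrite /v' !subrK.
rewrite /translate !e; apply: gx => i hi.
by rewrite /v' vx /translate ?addrK//; lia.
Qed.

End Translation.

Section Divergence.
Local Open Scope classical_set_scope.
Context {R : realType} {r : nat} (lam kap : R) (F : 'I_r -> R -> R -> R).
Hypotheses (r_gt0 : (0 < r)%N) (lam_gt0 : 0 < lam) (kap_gt0 : 0 < kap).
Hypothesis FP : forall k, twist_pot lam kap (F k).
Variables (x : int -> R) (k : nat) (l : int).
Hypotheses (gx : gmin F x) (k_gt0 : (0 < k)%N).
Hypothesis step_bound : k = 1%N \/ exists alpha beta : R,
  (forall i, alpha <= x (i + 1) - x i <= beta) /\
  alpha * k%:R <= l%:~R <= beta * k%:R.

Lemma per_minimizer_for : exists (G : set R) w,
  [/\ is_interval G, incr_in G x, per k l w, incr_in G w &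
      per_lower_bound F G k l (En F 0 k w)].
Proof.
case: step_bound => [k1|[alpha [beta [xD lk]]]]; last first.
  have [w [pw Gw Hw]] := per_minimizer_exists (ltW lam_gt0) kap_gt0 FP k_gt0 lk.
  exists [set s : R | alpha <= s <= beta], w; split=> //.
  move=> a b /= /andP[a1 a2] /andP[b1 b2] z /andP[z1 z2].
  by rewrite (le_trans a1)//= (le_trans z2).
have ll : (l%:~R : R) * k%:R <= l%:~R <= (l%:~R : R) * k%:R by rewrite k1 mulr1 lexx.
have [w [pw Gw Hw]] := per_minimizer_exists (ltW lam_gt0) kap_gt0 FP k_gt0 ll.
exists setT, w; split=> // v pv _; apply: Hw => // i.
by have := pv i; rewrite k1 /= => ->; rewrite addrC addKr lexx.
Qed.

Let rho : R := l%:~R / k%:R.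
Let z i : R := x i - rho * i%:~R.
Let Y (i : int) : R := \sum_(s < k) z (i - s%:Z).
Let u (i : int) : R := x i - x (i - k%:Z) - l%:~R.

(* Summing z over k consecutive sites turns the k-step difference u into a
   one-step difference. *)
Let Y_step i : Y i = Y (i - 1) + u i.
Proof.
have : \sum_(0 <= s < k) (- z (i - s.+1%:Z) - (- z (i - s%:Z))) = z i - z (i - k%:Z).
  by rewrite (telescope_sumr (fun s : nat => - z (i - s%:Z)))// subr0 opprK addrC.
rewrite big_mkord big_split/= sumrN; under [X in _ + X]eq_bigr do rewrite opprK.
have -> : \sum_(s < k) z (i - s.+1%:Z) = Y (i - 1).
  by apply: eq_bigr => s _; congr z; lia.
rewrite -/(Y i) => /eqP; rewrite addrC subr_eq => /eqP ->.
rewrite addrC; congr (_ + _); rewrite /z /u intrD mulrDr intrN mulrN.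
have -> : rho * (k%:Z)%:~R = l%:~R by rewrite /rho -pmulrn divfK// pnatr_eq0 -lt0n.
ring.
Qed.

Let z_lower : exists C, forall i, Y i - C <= k%:R * z i.
Proof.
suff [C HC] : exists C, forall i (s : 'I_k), z (i - s%:Z) - z i <= C.
  exists (k%:R * C) => i; rewrite lerBlDl -mulrDr /Y.
  apply: (@le_trans _ _ (\sum_(s < k) (C + z i))).
    by apply: ler_sum => s _; rewrite -lerBlDr.
  by rewrite sumr_const card_ord mulr_natl.
case: step_bound => [k1|[alpha [beta [xD _]]]].
  exists 0 => i s; have -> : i - s%:Z = i by have := ltn_ord s; lia.
  by rewrite subrr.
pose D := `|rho - alpha|.
have H i (s : nat) : z (i - s%:Z) - z i <= s%:R * D.
  elim: s => [|s IH]; first by rewrite subr0 subrr mul0r.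
  have /andP[h1 _] := xD (i - s.+1%:Z).
  have e : i - s.+1%:Z + 1 = i - s%:Z by lia.
  rewrite -natr1 mulrDl mul1r.
  have : z (i - s.+1%:Z) - z (i - s%:Z) <= D.
    apply: le_trans (ler_norm (rho - alpha)).
    by rewrite /z -e (intrD _ (i - s.+1%:Z) 1) mulrDr mulr1; lra.
  by lra.
exists (k%:R * D) => i s; apply: le_trans (H i s) _.
by rewrite ler_wpM2r ?normr_ge0// ler_nat ltnW.
Qed.

Lemma no_divergence :
  (forall C, exists L1, forall L, (L1 <= L)%N -> C <= \sum_(i < L) u i%:Z) ->
  (forall C, exists L1, forall L, (L1 <= L)%N -> C <= \sum_(i < L) - u (- 1 - i%:Z)) ->
  False.
Proof.
move=> right left.
have YR (L : nat) : Y (L%:Z - 1) = Y (- 1) + \sum_(i < L) u i%:Z.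
  elim: L => [|L IH]; first by rewrite big_ord0 addr0 add0r.
  rewrite big_ord_recr/= addrA -IH (_ : L.+1%:Z - 1 = L%:Z); last lia.
  exact: Y_step.
have YL (L : nat) : Y (- 1 - L%:Z) = Y (- 1) + \sum_(i < L) - u (- 1 - i%:Z).
  elim: L => [|L IH]; first by rewrite big_ord0 !addr0.
  rewrite big_ord_recr/= addrA -IH (Y_step (- 1 - L%:Z)).
  by rewrite (_ : - 1 - L.+1%:Z = - 1 - L%:Z - 1) ?addrK//; lia.
have Yinf C : exists A : nat, forall i : int, (A <= `|i|)%N -> C <= Y i.
  have [LR hR] := right (C - Y (- 1)); have [LL hL] := left (C - Y (- 1)).
  exists (LR + LL + 1)%N => i hi; have [i0|i0] := leP 0 i.
    have -> : i = `|i|.+1%:Z - 1 by lia.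
    by rewrite YR -lerBlDl; apply: hR; lia.
  have -> : i = - 1 - `|i|.-1%:Z by lia.
  by rewrite YL -lerBlDl; apply: hL; lia.
have k0 : 0 < k%:R :> R by rewrite ltr0n.
have zinf C : exists A : nat, forall i : int, (A <= `|i|)%N -> C <= z i.
  have [C0 hC0] := z_lower; have [A hA] := Yinf (k%:R * C + C0).
  exists A => i /hA h; rewrite -(ler_pM2l k0); apply: le_trans (hC0 i).
  by rewrite lerBrDr.
have [G [w [iG Gx pw Gw Hw]]] := per_minimizer_for.
have [Cw hCw] : exists C, forall i, w i - rho * i%:~R <= C.
  exists (\sum_(j < k) `|w j%:Z - rho * j%:Z%:~R|).
  apply: (@int_window k (fun i => w i - rho * i%:~R <= _) 0 k_gt0).
    move=> i; rewrite pw intrD mulrDr.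
    have -> : rho * (k%:Z)%:~R = l%:~R by rewrite /rho -pmulrn divfK// gt_eqF.
    by rewrite opprD addrACA subrr addr0.
  move=> i hi; have ik : (`|i| < k)%N by lia.
  rewrite (bigD1 (Ordinal ik))//= ler_wpDr ?sumr_ge0//.
  have -> : `|i|%N%:Z = i by lia.
  exact: ler_norm.
pose m := Num.floor (x 0 - w 0) + 1.
pose y i := w i + m%:~R.
have xy0 : x 0 < y 0 by rewrite /y -ltrBlDl floorD1_gt.
have [A hA] := zinf (Cw + m%:~R + 1).
have yx i : (A <= `|i|)%N -> y i < x i.
  by move=> /hA h; have := hCw i; rewrite /z in h; rewrite /y; lra.
have py : per k l y by move=> i; rewrite /y pw addrAC.
have Gy : incr_in G y by move=> i; rewrite /y opprD addrACA subrr addr0; exact: Gw.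
have Hy : per_lower_bound F G k l (En F 0 k y).
  by move=> v pv Gv; rewrite /y (En_addz FP); exact: Hw.
have [|delta [A' [d0 hd]]] := crossing_cost r_gt0 lam_gt0 kap_gt0 FP gx xy0 (yx A%:Z _).
  by [].
pose T := (A + A' + r)%N.
pose M := (2 ^ (T + T + r) * k)%N.
have TM : (T + T + r < M)%N.
  by apply: leq_trans (ltn_expl _ (ltnSn 1)) _; rewrite leq_pmulr.
pose L := (M - r)%N; pose a : int := - T%:Z.
have rLM : (r + L)%N = M by rewrite /L; lia.
have v_min : swapZ' a L x y = vmin x y.
  apply: funext => i; rewrite /swapZ' /vmin.
  have [xy|yx'] := ltP (x i) (y i); rewrite /= ?andbT//.
  case: ifP => // h; have := yx i; rewrite ltNge (ltW xy) => H.
  have : (A <= `|i|)%N by rewrite /a /L /T in h *; lia.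
  by move=> /H.
have := hd a L; rewrite rLM.
have -> : a <= - A'%:Z by rewrite /a /T; lia.
have -> : A'%:Z <= a + L%:Z by rewrite /a /T /L; rewrite /T in TM; lia.
have En_le : En F (a - r%:Z) M y <= En F (a - r%:Z) M (swapZ' a L x y).
  apply: (per_minimizer_compact FP (ltW lam_gt0) iG r_gt0 _ py Hy) => //.
  - by rewrite -/M; lia.
  - by rewrite v_min; exact: incr_in_min.
  - move=> i hi; rewrite /swapZ'; have -> : (a <= i < a + L%:Z) = false by lia.
    by rewrite andbF.
move=> /(_ isT isT En_le); apply/negP; rewrite -ltNge.
have w0 (c : int) : (forall i : nat, (i < r)%N -> (A <= `|(c + i%:Z)%R|)%N) -> wind r (gapZ x y) c = 0.
  by move=> h; apply: big1 => i _; rewrite /shift /gapZ gap_ge// ltW// yx// add0n h.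
rewrite /flux w0 ?mul0r ?add0r; last by move=> i ir; rewrite /a /T; lia.
rewrite [wind _ _ (a + _)]w0 ?mulr0// => i ir.
by rewrite /T in TM; rewrite /a /L /T; lia.
Qed.

End Divergence.

Section Reflection.
Context {R : realType} (r : nat).
Implicit Types n p : int -> R.

Definition bshift n (i : nat) : R := n (- 1 - i%:Z).

Lemma winN_bshift n b : winN r (bshift n) b = wind r n (- (b + r)%N%:Z).
Proof.
rewrite /wind /winN (reindex_inj rev_ord_inj)/=; apply: eq_bigr => i _.
by rewrite /bshift /shift; congr n; have := ltn_ord i; lia.
Qed.

Lemma crossN_bshift n p L : crossN r (bshift n) (bshift p) L = cross r n p (- L%:Z) L.
Proof.
rewrite /cross /crossN (reindex_inj rev_ord_inj)/=; apply: eq_bigr => i _.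
rewrite (reindex_inj rev_ord_inj)/=; have iL := ltn_ord i.
apply: eq_big => [j|j _]; have jL := ltn_ord j; first by lia.
by rewrite /bshift /shift; congr (n _ * p _); lia.
Qed.

Lemma flux_shift n L : (r <= L)%N ->
  flux r n L%:Z = winN r (shift n 0) (L - r) * winN r (shift n 0) L.
Proof.
by move=> rL; rewrite /flux !winN_shift !add0r subzn.
Qed.

Lemma flux_bshift n L : (r <= L)%N ->
  flux r n (- L%:Z) = winN r (bshift n) (L - r) * winN r (bshift n) L.
Proof.
move=> rL; rewrite /flux !winN_bshift subnK// mulrC; congr (_ * wind _ _ _); lia.
Qed.

Lemma cross_term n p (i j : int) : (forall a, 0 <= n a) -> (forall a, 0 <= p a) ->
  `|j - i| <= r%:Z -> exists a, n i * p j <= cross r n p a r.+1.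
Proof.
move=> n0 p0 ij; pose a := if i <= j then i else j; exists a.
have ia : a + `|i - a|%N%:Z = i by rewrite /a; case: ifP; lia.
have ja : a + `|j - a|%N%:Z = j by rewrite /a; case: ifP; lia.
rewrite -[in leLHS]ia -[in leLHS]ja.
by apply: crossN_term; [move=> ?; exact: n0|move=> ?; exact: p0|..];
  rewrite /a; case: ifP; lia.
Qed.

End Reflection.

Section Growth.
Context {R : realType} (r : nat).
Implicit Types n p : int -> R.

Definition grows n p (d : nat) : Prop := exists k l : nat -> int,
  [/\ monotone_seq k /\ monotone_seq l,
      forall q, `|k q.+1 - k q| <= d%:Z,
      forall q, `|l q - k q| <= r%:Z &
      forall q, 2 ^+ q <= p (k q) * n (l q)].

Definition unbounded_crossing n p : Prop :=
  (forall B, exists L : nat, B < cross r n p 0 L) \/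
  (forall B, exists L : nat, B < cross r n p (- L%:Z) L).

Lemma grows_of_unbounded n p (theta : R) (s : nat) :
  (forall i, 0 <= n i) -> (forall i, 0 <= p i) ->
  (0 < r)%N -> 0 < theta -> 2 <= (1 + theta ^+ 2) ^+ s ->
  (forall a L, 2 * theta * cross r n p a L <= flux r n a + flux r n (a + L%:Z)) ->
  (forall a L, 2 * theta * cross r n p a L <= flux r p a + flux r p (a + L%:Z)) ->
  unbounded_crossing n p -> grows n p (s * r + r).
Proof.
move=> n0 p0 r0 th0 hs Hn Hp unb.
have s0 : (0 < s)%N.
  by rewrite lt0n; apply/eqP => s0; move: hs; rewrite s0 expr0; lra.
have fl0 (w : int -> R) a : (forall i, 0 <= w i) -> 0 <= flux r w a.
  by move=> w0; apply: mulr_ge0; apply: sumr_ge0 => i _; exact: w0.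
case: unb => unb.
- have [|||||m hm] := @growth_of_unbounded R r (shift n 0) (shift p 0) _ _ theta
      (flux r n 0 + flux r p 0) s r0 th0 hs.
  + by move=> i; exact: n0.
  + by move=> i; exact: p0.
  + move=> L rL; rewrite -flux_shift//; have := Hn 0 L; rewrite add0r.
    by have := fl0 p 0 p0; rewrite /cross; lra.
  + move=> L rL; rewrite -flux_shift//; have := Hp 0 L; rewrite add0r.
    by have := fl0 n 0 n0; rewrite /cross; lra.
  + exact: unb.
  have [k hk] := choice hm; have [l hl] := choice hk.
  exists (fun q => (k q)%:Z), (fun q => (l q)%:Z); split.
  + split; left; apply/nondecreasing_seqP => q;
      have [] := hl q; have [] := hl q.+1; rewrite mulSn; nia.
  + move=> q; have [h1 _ _] := hl q; have [h2 _ _] := hl q.+1.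
    by rewrite mulSn in h2; lia.
  + by move=> q; have [h1 h2 _] := hl q; lia.
  + by move=> q; have [_ _] := hl q; rewrite /shift !add0r.
- have [|||||m hm] := @growth_of_unbounded R r (bshift n) (bshift p) _ _ theta
      (flux r n 0 + flux r p 0) s r0 th0 hs.
  + by move=> i; exact: n0.
  + by move=> i; exact: p0.
  + move=> L rL; rewrite -flux_bshift//; have := Hn (- L%:Z) L; rewrite addNr.
    by have := fl0 p 0 p0; rewrite crossN_bshift; lra.
  + move=> L rL; rewrite -flux_bshift//; have := Hp (- L%:Z) L; rewrite addNr.
    by have := fl0 n 0 n0; rewrite crossN_bshift; lra.
  + by move=> B; have [L hL] := unb B; exists L; rewrite crossN_bshift.
  have [k hk] := choice hm; have [l hl] := choice hk.
  exists (fun q => - 1 - (k q)%:Z), (fun q => - 1 - (l q)%:Z); split.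
  + split; right; apply/nonincreasing_seqP => q;
      have [] := hl q; have [] := hl q.+1; rewrite mulSn; nia.
  + move=> q; have [h1 _ _] := hl q; have [h2 _ _] := hl q.+1.
    by rewrite mulSn in h2; lia.
  + by move=> q; have [h1 h2 _] := hl q; lia.
  + by move=> q; have [_ _] := hl q.
Qed.

Lemma flux_dichotomy (phi : int -> R) (delta : R) (A : nat) :
  (forall (a : int) (L : nat), a <= - A%:Z -> A%:Z <= a + L%:Z ->
     delta <= phi a + phi (a + L%:Z)) ->
  (forall L : nat, (A <= L)%N -> delta / 2 <= phi (- L%:Z)) \/
  (forall L : nat, (A <= L)%N -> delta / 2 <= phi L%:Z).
Proof.
move=> H; apply: contrapT => /not_orP[/existsNP[L1 /not_implyP[h1 h2]]].
move=> /existsNP[L2 /not_implyP[h3 h4]].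
have := H (- L1%:Z) (L1 + L2)%N; rewrite PoszD addKr.
have -> : - L1%:Z <= - A%:Z by lia.
have -> : A%:Z <= L2%:Z by lia.
by move=> /(_ isT isT); move/negP: h2; move/negP: h4; rewrite -!ltNge; lra.
Qed.

End Growth.

Section Steps.
Context {R : realType}.
Implicit Type x : int -> R.

Definition step_bounded x : Prop :=
  exists alpha beta : R, forall i, alpha <= x (i + 1) - x i <= beta.

Lemma step_bounded_sum x (alpha beta : R) i (s : nat) :
  (forall i, alpha <= x (i + 1) - x i <= beta) ->
  alpha * s%:R <= x (i + s%:Z) - x i <= beta * s%:R.
Proof.
move=> xD; elim: s => [|s /andP[h1 h2]]; first by rewrite !mulr0 addr0 subrr lexx.
have /andP[h3 h4] := xD (i + s%:Z).
have -> : i + s.+1%:Z = i + s%:Z + 1 by lia.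
by rewrite -natr1 !mulrDr !mulr1; apply/andP; split; lra.
Qed.

End Steps.

Section Crossing.
Context {R : realType} {r : nat} (lam kap : R).
Hypotheses (r_gt0 : (0 < r)%N) (lam_gt0 : 0 < lam) (kap_gt0 : 0 < kap).
Implicit Types (F : 'I_r -> R -> R -> R) (x y : int -> R).

Lemma swap_min F x y a L : gmin F y ->
  En F (a - r%:Z) (r + L) y <= En F (a - r%:Z) (r + L) (swapZ' a L x y).
Proof.
move=> gy; apply: gy => i hi; rewrite /swapZ'.
have -> : (a <= i < a + L%:Z) = false by lia.
by rewrite andbF.
Qed.

Lemma cross_sym n p a L : cross r n p a L = cross r p n a L :> R.
Proof. exact: crossN_sym. Qed.

Lemma cross_flux F x y a L : (forall k, twist_pot lam kap (F k)) ->
  gmin F x -> gmin F y ->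
  lam / kap * cross r (gapZ x y) (gapZ y x) a L <=
  flux r (gapZ x y) a + flux r (gapZ x y) (a + L%:Z).
Proof.
move=> FP gx gy.
have := cross_le_flux (ltW lam_gt0) (ltW kap_gt0) FP gx (swap_min x a L gy).
by rewrite mulrAC ler_pdivrMr// [in leRHS]mulrC.
Qed.

Lemma gap_sub (a b : R) : gap a b - gap b a = b - a.
Proof.
have [h|h] := leP a b; first by rewrite (gap_lt h) (gap_ge h) subr0.
by rewrite (gap_ge (ltW h)) (gap_lt (ltW h)) add0r opprB.
Qed.

Lemma crossing_dichotomy F x y p q : (forall k, twist_pot lam kap (F k)) ->
  gmin F x -> gmin F y -> x q < y q -> y p < x p ->
  ~ unbounded_crossing r (gapZ x y) (gapZ y x) ->
  (forall C, exists L1, forall L, (L1 <= L)%N -> C <= \sum_(i < L) (y i%:Z - x i%:Z)) \/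
  (forall C, exists L1, forall L, (L1 <= L)%N ->
     C <= \sum_(i < L) (y (- 1 - i%:Z) - x (- 1 - i%:Z))).
Proof.
move=> FP gx gy xyq yxp /not_orP[/existsNP[B1 b1] /existsNP[B2 b2]].
have [delta [A [d0 hd]]] := crossing_cost r_gt0 lam_gt0 kap_gt0 FP gx xyq yxp.
have bnd1 L : crossN r (shift (gapZ y x) 0) (shift (gapZ x y) 0) L <= B1.
  by rewrite crossN_sym leNgt; apply/negP => h; apply: b1; exists L.
have bnd2 L : crossN r (bshift (gapZ y x)) (bshift (gapZ x y)) L <= B2.
  rewrite crossN_bshift cross_sym leNgt; apply/negP => h; apply: b2.
  by exists L.
have := @flux_dichotomy R (flux r (gapZ x y)) delta A.
have hd' a L h1 h2 := hd a L h1 h2 (swap_min x a L gy).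
have d2 : 0 < delta / 2 by rewrite divr_gt0.
have ge0 (v w : int -> R) i : 0 <= gapZ v w i by exact: gap_ge0.
move=> /(_ hd')[H|H]; [right|left] => C.
  have [|||L1 hL1] := @sum_diverges R r (bshift (gapZ y x)) (bshift (gapZ x y))
    B2 (delta / 2) (A + r) _ _ bnd2 d2 (leq_addl _ _) _ C.
  - by move=> i; exact: ge0.
  - by move=> i; exact: ge0.
  - by move=> L hL; rewrite -flux_bshift ?H//; lia.
  exists L1 => L /hL1; under eq_bigr do rewrite /bshift /gapZ gap_sub.
  by [].
have [|||L1 hL1] := @sum_diverges R r (shift (gapZ y x) 0) (shift (gapZ x y) 0)
    B1 (delta / 2) (A + r) _ _ bnd1 d2 (leq_addl _ _) _ C.
- by move=> i; exact: ge0.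
- by move=> i; exact: ge0.
- by move=> L hL; rewrite -flux_shift ?H//; lia.
exists L1 => L /hL1; under eq_bigr do rewrite /shift /gapZ gap_sub add0r.
by [].
Qed.

Lemma translate_crossing_unbounded F x (k : nat) (l p q : int)
    (y := translate k%:Z l x) :
  (forall j, twist_pot lam kap (F j)) -> gmin F x -> (0 < k)%N ->
  k = 1%N \/ step_bounded x -> x q < y q -> y p < x p ->
  unbounded_crossing r (gapZ x y) (gapZ y x).
Proof.
move=> FP gx k0 Hk xyq yxp; apply: contrapT => nunb.
have gy : gmin F y by exact: (gmin_translate FP).
have sb : k = 1%N \/ exists alpha beta : R,
    (forall i, alpha <= x (i + 1) - x i <= beta) /\
    alpha * k%:R <= l%:~R <= beta * k%:R.
  case: Hk => [->|[alpha [beta xD]]]; [by left|right].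
  exists alpha, beta; split => //.
  have := step_bounded_sum (q - k%:Z) k xD; have := step_bounded_sum (p - k%:Z) k xD.
  rewrite !subrK.
  move: xyq yxp; rewrite /y /translate => h1 h2 /andP[h3 h4] /andP[h5 h6].
  by apply/andP; split; lra.
have nunb' : ~ unbounded_crossing r (gapZ y x) (gapZ x y).
  by case=> H; apply: nunb; [left|right] => B; have [L] := H B; rewrite cross_sym; exists L.
have opp (v w : nat -> R) : (forall C, exists L1, forall L, (L1 <= L)%N -> C <= \sum_(i < L) (v i - w i)) ->
   (forall C, exists L1, forall L, (L1 <= L)%N -> C <= \sum_(i < L) (w i - v i)) -> False.
  move=> H1 H2; have [L1 h1] := H1 1; have [L2 h2] := H2 1.
  have := h1 (L1 + L2)%N (leq_addr _ _); have := h2 (L1 + L2)%N (leq_addl _ _).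
  by rewrite !sumrB; lra.
have [HR|HL] := crossing_dichotomy FP gx gy xyq yxp nunb;
  have [HR'|HL'] := crossing_dichotomy FP gy gx yxp xyq nunb'.
- exact: (opp (fun i => y i%:Z) (fun i => x i%:Z) HR HR').
- apply: (@no_divergence _ _ lam kap (fun j a b => F j (- a) (- b)) r_gt0 lam_gt0 kap_gt0
     (fun j => twist_pot_neg (FP j)) (fun i => - x i) k (- l) (gmin_neg gx) k0).
  + case: sb => [->|[alpha [beta [xD /andP[l1 l2]]]]]; [by left|right].
    exists (- beta), (- alpha); split; last by rewrite intrN !mulNr !lerN2 l1 l2.
    by move=> i; have /andP[h1 h2] := xD i; apply/andP; split; lra.
  + move=> C; have [L1 h] := HR C; exists L1 => L /h; congr (_ <= _).
    by apply: eq_bigr => i _; rewrite /y /translate intrN; ring.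
  + move=> C; have [L1 h] := HL' C; exists L1 => L /h; congr (_ <= _).
    by apply: eq_bigr => i _; rewrite /y /translate intrN; ring.
- apply: (no_divergence r_gt0 lam_gt0 kap_gt0 FP gx k0 sb).
  + move=> C; have [L1 h] := HR' C; exists L1 => L /h; congr (_ <= _).
    by apply: eq_bigr => i _; rewrite /y /translate; ring.
  + move=> C; have [L1 h] := HL C; exists L1 => L /h; congr (_ <= _).
    by apply: eq_bigr => i _; rewrite /y /translate; ring.
- exact: (opp (fun i => y (- 1 - i%:Z)) (fun i => x (- 1 - i%:Z)) HL HL').
Qed.

Lemma translate_crossing_grows F x (k : nat) (l p q : int) (s : nat)
    (y := translate k%:Z l x) :
  (forall j, twist_pot lam kap (F j)) -> gmin F x -> (0 < k)%N ->
  k = 1%N \/ step_bounded x -> x q < y q -> y p < x p ->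
  2 <= (1 + (lam / (2 * kap)) ^+ 2) ^+ s ->
  grows r (gapZ x y) (gapZ y x) (s * r + r).
Proof.
move=> FP gx k0 Hk xyq yxp hs.
have gy : gmin F y by exact: (gmin_translate FP).
have e : 2 * (lam / (2 * kap)) = lam / kap by field; rewrite gt_eqF.
apply: (@grows_of_unbounded _ _ _ _ (lam / (2 * kap))) => //.
- by move=> i; exact: gap_ge0.
- by move=> i; exact: gap_ge0.
- by apply: divr_gt0 => //; apply: mulr_gt0.
- by move=> a L; rewrite e; exact: cross_flux.
- by move=> a L; rewrite e cross_sym; exact: cross_flux.
- exact: (translate_crossing_unbounded FP gx k0 Hk xyq yxp).
Qed.

End Crossing.

Section NonBirkhoff.
Context {R : realType} {r : nat} (lam kap : R).
Hypotheses (r_gt0 : (0 < r)%N) (lam_gt0 : 0 < lam) (kap_gt0 : 0 < kap).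
Implicit Types (F : 'I_r -> R -> R -> R) (x y : int -> R).

Lemma exists_pow_gt (e B : R) : 0 < e -> exists s : nat, B <= (1 + e) ^+ s.
Proof.
move=> e0; have H (s : nat) : s%:R * e <= (1 + e) ^+ s.
  have : 1 + s%:R * e <= (1 + e) ^+ s.
    elim: s => [|s IH]; first by rewrite mul0r addr0.
    have s0 : 0 <= s%:R * e * e by rewrite !mulr_ge0// ltW.
    rewrite exprS; apply: (@le_trans _ _ ((1 + e) * (1 + s%:R * e))).
      by rewrite -natr1; lra.
    by rewrite ler_wpM2l// addr_ge0// ltW.
  by apply: le_trans; rewrite lerDr.
exists (Num.truncn (`|B| / e)).+1; apply: le_trans (H _).
rewrite -ler_pdivrMr// ltW// (le_lt_trans _ (truncnS_gt _))//.
by rewrite ler_pM2r ?invr_gt0// ler_norm.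
Qed.

Lemma not_Birkhoff_crossing x : ~ Birkhoff x ->
  exists (k : nat) (l p q : int), [/\ (0 < k)%N,
    x q < translate k%:Z l x q & translate k%:Z l x p < x p].
Proof.
move=> /existsNP[k /existsNP[l /not_orP[/existsNP[q /negP q1] /existsNP[p /negP p1]]]].
rewrite -!ltNge in q1 p1.
case: (ltgtP k 0) => [k0|k0|k0].
- exists `|k|%N, (- l), (q - k), (p - k); split; first by lia.
    rewrite /translate; have -> : p - k - `|k|%N%:Z = p by lia.
    by move: p1; rewrite /translate intrN; lra.
  rewrite /translate; have -> : q - k - `|k|%N%:Z = q by lia.
  by move: q1; rewrite /translate intrN; lra.
- exists `|k|%N, l, p, q; have -> : `|k|%N%:Z = k by lia.
  by split=> //; lia.
- by move: q1 p1; rewrite k0 /translate !subr0; lra.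
Qed.

Lemma bounded_not_grows x (k : nat) (l : int) d : step_bounded x ->
  ~ grows r (gapZ x (translate k%:Z l x)) (gapZ (translate k%:Z l x) x) d.
Proof.
move=> [alpha [beta xD]] [u [v [_ _ _ uv]]].
pose C : R := `|alpha * k%:R| + `|beta * k%:R| + `|l%:~R|.
have H i : `|x i - translate k%:Z l x i| <= C.
  have := step_bounded_sum (i - k%:Z) k xD; rewrite subrK /translate => /andP[h1 h2].
  have := ler_norm (beta * k%:R); have := ler_norm (- (alpha * k%:R)).
  have := ler_norm (l%:~R : R); have := ler_norm (- l%:~R : R); rewrite !normrN.
  have := normr_ge0 (alpha * k%:R); have := normr_ge0 (beta * k%:R).
  by move=> *; rewrite ler_norml /C; apply/andP; split; lra.
have C0 : 0 <= C by exact: le_trans (normr_ge0 _) (H 0).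
have gapC a b : `|a - b| <= C -> gap a b <= C.
  by rewrite /gap ge_max C0 andbT distrC; apply: le_trans (ler_norm _).
have [s hs] := @exists_pow_gt 1 (C * C + 1) ltr01.
have := uv s; apply/negP; rewrite -ltNge.
apply: (@le_lt_trans _ _ (C * C)).
  by apply: ler_pM; rewrite ?gap_ge0// gapC// distrC.
by have -> : (2 : R) = 1 + 1 by []; lra.
Qed.

Lemma step_bounded_of_no_crossing x :
  (forall (c p q : int), x q < translate 1 c x q -> ~ translate 1 c x p < x p) ->
  step_bounded x.
Proof.
move=> H; pose c := Num.floor (x 0 - x (- 1)).
have h1 : c%:~R <= x 0 - x (- 1) by exact: ge_floor.
have h2 : x 0 - x (- 1) < c%:~R + 1 by have := floorD1_gt (x 0 - x (- 1)); rewrite intrD.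
exists (c%:~R - 1), (c%:~R + 1) => i; apply/andP; split; rewrite leNgt; apply/negP => h.
  apply: (H (c - 1) 0 (i + 1)); rewrite /translate ?addrK ?sub0r intrD intrN; lra.
apply: (H (c + 1) (i + 1) 0); rewrite /translate ?addrK ?sub0r intrD; lra.
Qed.

Lemma step_negative F x (c p q : int) :
  (forall j, twist_pot lam kap (F j)) -> gmin F x ->
  x q < translate 1 c x q -> translate 1 c x p < x p ->
  exists i, x i < x (i - 1).
Proof.
move=> FP gx xq xp; apply: contrapT => /forallNP H.
have D0 i : x (i - 1) <= x i by rewrite leNgt; apply/negP; exact: H.
have c0 : 0 < c%:~R :> R by have := D0 q; move: xq; rewrite /translate; lra.
have e0 : 0 < (lam / (2 * kap)) ^+ 2 by rewrite exprn_gt0// divr_gt0// mulr_gt0.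
have [s hs] := exists_pow_gt 2 e0.
have := @translate_crossing_grows _ _ lam kap r_gt0 lam_gt0 kap_gt0 F x 1 c p q s FP gx
  isT (or_introl erefl) xq xp hs.
move=> [u [v [_ _ uv prod]]].
pose y := translate 1 (c + 1) x.
have gy : gmin F y by exact: (gmin_translate FP).
pose C : R := c%:~R + 1.
have C0 : 0 < C by rewrite /C; lra.
have gC i : gapZ x y i <= C.
  rewrite /gapZ /gap ge_max (ltW C0) andbT /y /translate intrD.
  by have := D0 i; rewrite /C; lra.
have windC a : wind r (gapZ x y) a <= r%:R * C.
  apply: (@le_trans _ _ (\sum_(i < r) C)); first by apply: ler_sum => i _; exact: gC.
  by rewrite sumr_const card_ord mulr_natl.
have wind0 a : 0 <= wind r (gapZ x y) a.
  by apply: sumr_ge0 => i _; exact: gap_ge0.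
have fluxC a : flux r (gapZ x y) a <= (r%:R * C) ^+ 2.
  by rewrite expr2; apply: ler_pM.
pose B := 2 * (r%:R * C) ^+ 2.
have crossB a L : lam / kap * cross r (gapZ x y) (gapZ y x) a L <= B.
  apply: le_trans (cross_flux r_gt0 lam_gt0 kap_gt0 a L FP gx gy) _.
  by rewrite /B; have := fluxC a; have := fluxC (a + L%:Z); lra.
have B0 : 0 <= B by rewrite /B mulr_ge0// sqr_ge0.
have [Q [Q0 hQ]] : exists Q : R, 0 <= Q /\ lam / kap * (Q + 1) = B + lam / kap.
  exists (B * kap / lam); split; last by field; rewrite !gt_eqF.
  by rewrite divr_ge0 ?(ltW lam_gt0)// mulr_ge0// ltW.
have [m hm] := @exists_pow_gt 1 (C * (Q + 2)) ltr01.
have pm := prod m; have uvm := uv m.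
set i := u m in pm uvm; set j := v m in pm uvm.
have p0 : 0 < gapZ (translate 1 c x) x i * gapZ x (translate 1 c x) j.
  by apply: lt_le_trans pm; rewrite exprn_gt0.
have n0 : 0 < gapZ x (translate 1 c x) j.
  by rewrite lt_def gap_ge0 andbT; apply: contraTneq p0 => ->; rewrite mulr0 ltxx.
have pi0 : 0 < gapZ (translate 1 c x) x i.
  by rewrite lt_def gap_ge0 andbT; apply: contraTneq p0 => ->; rewrite mul0r ltxx.
have jc : gapZ x (translate 1 c x) j <= C.
  rewrite /gapZ /gap ge_max (ltW C0) andbT /translate /C.
  by have := D0 j; lra.
have big : Q + 2 <= gapZ (translate 1 c x) x i.
  rewrite -(ler_pM2l C0); apply: le_trans hm _; apply: le_trans pm _.
  by rewrite mulrC ler_wpM2r// ltW.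
rewrite /gapZ gap_gt0 in n0; rewrite /gapZ gap_gt0 in pi0.
rewrite /gapZ (gap_lt (ltW pi0)) in big.
have nj : 1 <= gapZ x y j.
  move: n0; rewrite /translate => n0.
  rewrite /gapZ /y /translate intrD gap_lt; lra.
have pj : Q + 1 <= gapZ y x i.
  move: big; rewrite /gapZ /translate => big.
  rewrite /y /translate intrD gap_lt; lra.
have [a Hc] : exists a, gapZ x y j * gapZ y x i <= cross r (gapZ x y) (gapZ y x) a r.+1.
  by apply: cross_term => [?|?|]; [exact: gap_ge0|exact: gap_ge0|rewrite distrC].
have := crossB a r.+1; apply/negP; rewrite -ltNge.
apply: (@lt_le_trans _ _ (lam / kap * (gapZ x y j * gapZ y x i))); last first.
  by rewrite ler_wpM2l// divr_ge0// ltW.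
apply: (@lt_le_trans _ _ (lam / kap * (1 * (Q + 1)))); last first.
  apply: ler_wpM2l; first by rewrite divr_ge0// ltW.
  by apply: ler_pM => //; rewrite addr_ge0.
by rewrite mul1r hQ ltrDl divr_gt0.
Qed.

Lemma not_Birkhoff_unit_crossing F x :
  (forall j, twist_pot lam kap (F j)) -> gmin F x -> ~ Birkhoff x ->
  exists p q, x q < translate 1 0 x q /\ translate 1 0 x p < x p.
Proof.
move=> FP gx nB.
have e0 : 0 < (lam / (2 * kap)) ^+ 2 by rewrite exprn_gt0// divr_gt0// mulr_gt0.
have [s hs] := exists_pow_gt 2 e0.
have [c [p [q [xq xp]]]] : exists c p q : int,
    x q < translate 1 c x q /\ translate 1 c x p < x p.
  apply: contrapT => H.
  have sb : step_bounded x.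
    by apply: step_bounded_of_no_crossing => c p q h1 h2; apply: H; exists c, p, q.
  have [k [l [p [q [k0 xq xp]]]]] := not_Birkhoff_crossing nB.
  apply: (bounded_not_grows sb).
  exact: (translate_crossing_grows r_gt0 lam_gt0 kap_gt0 FP gx k0 (or_intror sb) xq xp hs).
have [i hi] := step_negative FP gx xq xp.
have [||j hj] := step_negative (x := fun i => - x i) (c := - c) (p := q) (q := p)
  (fun j => twist_pot_neg (FP j)) (gmin_neg gx).
- by move: xp; rewrite /translate intrN; lra.
- by move: xq; rewrite /translate intrN; lra.
exists j, i; rewrite /translate !addr0; split=> //.
by move: hj; rewrite ltrN2.
Qed.

End NonBirkhoff.

Unset Implicit Arguments.

Theorem mainTheorem3 (R : realType) (r : nat) (K lambda : R)
    (r_ge1 : (1 <= r)%N) (K_gt0 : 0 < K) (lambda_gt0 : 0 < lambda) :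
  exists d : nat,
  forall S : 'rV[R]_r.+1 -> R, local_energy K lambda S ->
  forall x : int -> R, global_minimizer S x ->
  Birkhoff x \/
  (~ Birkhoff x /\
   exists k l : nat -> int,
   [/\ monotone_seq k /\ monotone_seq l,
       forall n : nat, `|k n.+1 - k n| <= d%:Z,
       forall n : nat, `|l n - k n| <= r%:Z,
       (forall n : nat,
          (x (k n + 1) - x (k n) + 1) * (x (l n) - x (l n + 1) + 1) >= 2 ^+ n) \/
       (forall n : nat,
          (x (k n + 1) - x (k n) - 1) * (x (l n) - x (l n + 1) - 1) >= 2 ^+ n)
     & forall n : nat,
         x (k n + 1) - x (k n) >= 2 `^ (n%:R / 2) - 1 \/
         x (l n) - x (l n + 1) >= 2 `^ (n%:R / 2) - 1]).
Proof.
have kap0 : 0 < K / r%:R by rewrite divr_gt0// ltr0n.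
have e0 : 0 < (lambda / (2 * (K / r%:R))) ^+ 2.
  by rewrite exprn_gt0// divr_gt0// mulr_gt0.
have [s hs] := exists_pow_gt 2 e0.
exists (s * r + r)%N => S ES x mx.
have [F [FP Fmin]] := local_energy_twist ES.
have gx := Fmin x mx.
have [B|nB] := pselect (Birkhoff x); [by left|right; split=> //].
have [p [q [xq xp]]] := not_Birkhoff_unit_crossing r_ge1 lambda_gt0 kap0 FP gx nB.
have [k [l [[mk ml] kd lk prod]]] := translate_crossing_grows r_ge1 lambda_gt0 kap0 FP gx
  (isT : (0 < 1)%N) (or_introl erefl) xq xp hs.
have e i : translate 1 0 x i = x (i - 1) by rewrite /translate addr0.
have pos n : [/\ 0 < x (k n) - x (k n - 1), 0 < x (l n - 1) - x (l n) &
    2 ^+ n <= (x (k n) - x (k n - 1)) * (x (l n - 1) - x (l n))].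
  have := prod n; rewrite /gapZ !e.
  have [h1|h1] := leP (x (k n)) (x (k n - 1)).
    by rewrite (gap_ge h1) mul0r leNgt exprn_gt0.
  have [h2|h2] := leP (x (l n - 1)) (x (l n)).
    by rewrite (gap_ge h2) mulr0 leNgt exprn_gt0.
  by rewrite (gap_lt (ltW h1)) (gap_lt (ltW h2)) !subr_gt0.
have mono (u : nat -> int) : monotone_seq u -> monotone_seq (fun n => u n - 1).
  by case=> H; [left|right] => a b /H; rewrite lerD2r.
exists (fun n => k n - 1), (fun n => l n - 1); split.
- by split; apply: mono.
- by move=> n; have := kd n; lia.
- by move=> n; have := lk n; lia.
- left=> n; rewrite !subrK; have [h1 h2 h3] := pos n.
  by apply: le_trans h3 _; apply: ler_pM; lra.
- move=> n; rewrite !subrK; have [h1 h2 h3] := pos n.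
  set P := 2 `^ _; have P0 : 0 <= P by exact: powR_ge0.
  have PP : P * P = 2 ^+ n.
    rewrite /P -powRD; last by rewrite pnatr_eq0 implybT.
    by rewrite -splitr powR_mulrn.
  have [hk|hk] := leP (P - 1) (x (k n) - x (k n - 1)); first by left.
  right; rewrite leNgt; apply/negP => hl; move: h3; apply/negP; rewrite -ltNge -PP.
  by apply: ltr_pM; lra.
Qed.
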